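(* Let $n\geq1$ and $0<p_1,p_2<1$ with $p_1+p_2=1$. Let $(U_1,U_2)$ be the vector of observed counts in $n$ independent trials with two cells having classification probabilities $p_1,p_2$, let $\chi^2=\sum_{j=1}^2\frac{(U_j-np_j)^2}{np_j}$ be Pearson's statistic, and let $T_\lambda$ be the power divergence statistic with index $\lambda$. Then $$d_{\mathrm{K}}(\mathcal{L}(\chi^2),\chi^2_{(1)})\leq\frac{0.9496}{\sqrt{np_1p_2}}.$$ Let $\lambda>-1$. Then there exist universal constants $C_1,C_2,C_3>0$, independent of $n$, $p_1$, $p_2$ and $\lambda$, such that $$d_{\mathrm{K}}(\mathcal{L}(T_\lambda),\chi_{(1)}^2)\leq \frac{1}{(np_1p_2)^{1/5}}\bigg\{C_1+C_2(\lambda-1)^2+\frac{C_3|(\lambda-1)(\lambda-2)(12\lambda+13)|}{(\lambda+1)(np_1p_2)^{2/5}}\bigg\}.$$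
   Context: Each of the $n$ independent trials results in exactly one of the two classes, class $j$ having probability $p_j$; $U_j$ is the number of trials in class $j$, so $U_1\sim\mathrm{Bin}(n,p_1)$ and $U_2=n-U_1$. The power divergence statistic is $T_\lambda=\frac{2}{\lambda(\lambda+1)}\sum_{j=1}^2U_j\big[\big(\frac{U_j}{np_j}\big)^\lambda-1\big]$; for $\lambda=0$ it is understood as the limit $\lambda\to0$, i.e. $T_0=2\sum_{j=1}^2U_j\log\frac{U_j}{np_j}$ (terms with $U_j=0$ are interpreted by continuity). $\mathcal{L}(X)$ is the law of $X$, $\chi^2_{(1)}$ is the chi-square distribution with one degree of freedom, and the Kolmogorov distance between the laws of $X$ and $Y$ is $d_{\mathrm{K}}=\sup_{z\in\mathbb{R}}|\mathbb{P}(X\le z)-\mathbb{P}(Y\le z)|$. *)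

(* Defs.v *)
From HB Require Import structures.
From mathcomp Require Import all_boot all_order all_algebra.
From mathcomp Require Import all_classical all_reals all_analysis.
From mathcomp Require Import measurable_realfun.

Set Implicit Arguments.
Unset Strict Implicit.
Unset Printing Implicit Defensive.

Import Order.TTheory GRing.Theory Num.Theory.
Import numFieldNormedType.Exports.

Local Open Scope classical_set_scope.
Local Open Scope ring_scope.

HB.instance Definition _ (r : nat) := isPointed.Build 'I_r.+1 ord0.
HB.instance Definition _ (r : nat) :=
  @isMeasurable.Build default_measure_display 'I_r.+1 discrete_measurable
    discrete_measurable0 discrete_measurableC discrete_measurableU.

Definition mutually_independent d d' (T : measurableType d)
    (T' : measurableType d') (R : realType) (P : probability T R)
    (I : finType) (X : I -> {RV P >-> T'}) : Prop :=
  forall (J : {set I}) (A : I -> set T'), (forall i, measurable (A i)) ->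
    P (\bigcap_(i in [set` J]) (X i @^-1` A i)) =
    (\prod_(i in J) P (X i @^-1` A i))%E.

(* [X i] is the cell into which the [i]-th trial falls. *)
Definition classification_trials d (T : measurableType d) (R : realType)
    (P : probability T R) (n r : nat) (p : 'I_r.+1 -> R)
    (X : 'I_n -> {RV P >-> 'I_r.+1}) : Prop :=
  mutually_independent X /\
  forall i j, P (X i @^-1` [set j]) = (p j)%:E.

Definition cell_count d (T : measurableType d) (R : realType)
    (P : probability T R) (n r : nat) (X : 'I_n -> {RV P >-> 'I_r.+1})
    (j : 'I_r.+1) (w : T) : nat :=
  #|[set i | X i w == j]%SET|.

Definition pearson_stat d (T : measurableType d) (R : realType)
    (P : probability T R) (n r : nat) (p : 'I_r.+1 -> R)
    (X : 'I_n -> {RV P >-> 'I_r.+1}) (w : T) : R :=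
  \sum_(j < r.+1) ((cell_count X j w)%:R - n%:R * p j) ^+ 2 / (n%:R * p j).

(* The conventions [0 `^ lambda = 0] for [lambda != 0] and [ln 0 = 0] make the
   terms of the empty cells equal to their limits for [lambda > -1]. *)
Definition power_divergence_stat d (T : measurableType d) (R : realType)
    (P : probability T R) (n r : nat) (p : 'I_r.+1 -> R) (lambda : R)
    (X : 'I_n -> {RV P >-> 'I_r.+1}) (w : T) : R :=
  if lambda == 0 then
    2 * \sum_(j < r.+1) (cell_count X j w)%:R *
          ln ((cell_count X j w)%:R / (n%:R * p j))
  else
    2 / (lambda * (lambda + 1)) *
      \sum_(j < r.+1) (cell_count X j w)%:R *
        (((cell_count X j w)%:R / (n%:R * p j)) `^ lambda - 1).

Lemma measurable_cell_count d (T : measurableType d) (R : realType)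
    (P : probability T R) (n r : nat) (X : 'I_n -> {RV P >-> 'I_r.+1})
    (j : 'I_r.+1) :
  measurable_fun setT (fun w => (cell_count X j w)%:R : R).
Proof.
have -> : (fun w => (cell_count X j w)%:R : R) =
          (fun w => \sum_(i < n) \1_(X i @^-1` [set j]) w).
  apply/funext => w; rewrite /cell_count -sum1_card natr_sum big_mkcond.
  apply: eq_bigr => i _; rewrite indicE.
  have -> : (w \in X i @^-1` [set j]) = (X i w == j).
    by apply/idP/eqP; rewrite inE.
  by rewrite finset.inE; case: (X i w == j).
apply: measurable_sum => i; apply: measurable_indic.
exact: measurable_funPTI.
Qed.

Lemma measurable_pearson_stat d (T : measurableType d) (R : realType)
    (P : probability T R) (n r : nat) (p : 'I_r.+1 -> R)
    (X : 'I_n -> {RV P >-> 'I_r.+1}) :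
  measurable_fun setT (pearson_stat p X).
Proof.
apply: measurable_sum => j; apply: measurable_funM => //.
apply: measurable_funX; apply: measurable_funB => //.
exact: measurable_cell_count.
Qed.

HB.instance Definition _ d (T : measurableType d) (R : realType)
    (P : probability T R) (n r : nat) (p : 'I_r.+1 -> R)
    (X : 'I_n -> {RV P >-> 'I_r.+1}) :=
  isMeasurableFun.Build _ _ _ _ (pearson_stat p X)
    (measurable_pearson_stat p X).

Lemma measurable_power_divergence_stat d (T : measurableType d) (R : realType)
    (P : probability T R) (n r : nat) (p : 'I_r.+1 -> R) (lambda : R)
    (X : 'I_n -> {RV P >-> 'I_r.+1}) :
  measurable_fun setT (power_divergence_stat p lambda X).
Proof.
have mU j : measurable_fun setT (fun w => (cell_count X j w)%:R : R).
  exact: measurable_cell_count.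
rewrite /power_divergence_stat; case: (lambda == 0); apply: measurable_funM => //;
  apply: measurable_sum => j; apply: measurable_funM => //.
  by apply: (measurableT_comp (@measurable_ln R)); exact: measurable_funM.
apply: measurable_funB => //.
by apply: (measurableT_comp (@measurable_powR R lambda)); exact: measurable_funM.
Qed.

HB.instance Definition _ d (T : measurableType d) (R : realType)
    (P : probability T R) (n r : nat) (p : 'I_r.+1 -> R) (lambda : R)
    (X : 'I_n -> {RV P >-> 'I_r.+1}) :=
  isMeasurableFun.Build _ _ _ _ (power_divergence_stat p lambda X)
    (measurable_power_divergence_stat p lambda X).

(* The domain is [measurableTypeR R], the Borel sigma-algebra on which
   [normal_prob] is declared. *)
Definition square (R : realType) : {mfun measurableTypeR R >-> R} :=
  HB.pack_for {mfun measurableTypeR R >-> R} (fun x : R => x ^+ 2)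
    (@isMeasurableFun.Build _ _ (measurableTypeR R) R (fun x : R => x ^+ 2)
       (exprn_measurable 2)).

(* The chi-square distribution with one degree of freedom: the law of the
   square of a standard normal variable. *)
Definition chi_square1 (R : realType) : probability R R :=
  distribution (normal_prob (0 : R) 1) (square R).

Definition kolmogorov_dist (R : realType) (mu nu : probability R R) : R :=
  sup (range (fun z : R =>
    `|fine (mu `]-oo, z]%classic) - fine (nu `]-oo, z]%classic)|)).

(* Main.v *)
From HB Require Import structures.
Require Import Defs.
From mathcomp Require Import all_boot all_order all_algebra.
From mathcomp Require Import all_classical all_reals all_analysis.
From mathcomp Require Import ring lra zify.

Set Implicit Arguments.
Unset Strict Implicit.
Unset Printing Implicit Defensive.

Import Order.TTheory GRing.Theory Num.Theory.
Import numFieldNormedType.Exports.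

Local Open Scope classical_set_scope.
Local Open Scope ring_scope.

(** The statistics are functions of the count U of the first cell, a binomial
    variable with parameters n and p; put q = 1 - p, s = 1 / sqrt (n p q) and
    W = (U - n p) s.  For two cells Pearson's statistic is W ^ 2, so its
    distance to the chi-square law is the error of the normal approximation
    on the symmetric intervals [- z, z], at most twice the one-sided error.
    The first bound therefore follows from the Berry-Esseen inequality
    |P (W <= z) - Phi z| <= 0.4748 s and its analogue for W < z.  It is only
    needed when s <= 1.054, since for larger s the bound exceeds 1.

    The one-sided inequality comes from Zubkov and Serov's theorem
    ([binom_lt_le_lrt]): P (U < y) <= Phi (r (y)), where r (y) is the signed
    root of twice the log-likelihood ratio of y.  For fixed n and y, both
    sides are functions of p with the same limits at 0 and 1, and the
    derivative of their difference is the product of a positive factor and of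
    a constant minus an increasing function; the difference increases and
    then decreases, hence is nonnegative.  The reflection that exchanges p
    with q and U with n - U turns this into a lower bound.

    It remains to replace the root r by the standardized variable.  If v is
    the modulus of (y - n p) s, elementary bounds on the logarithm give
    r ^ 2 >= v ^ 2 / (1 + v s / 3) to the left of the mean and
    r <= v + 0.42 v ^ 2 s to its right.  The shift from y to y - 1 costs at
    most s / sqrt (2 pi), about 0.399 s, and the difference between r and v
    costs a multiple of s x ^ 2 exp (- x ^ 2 / 2), where x is r on the left
    and v on the right; [left_tail_ineq] and [right_tail_ineq] bound the sum
    of both effects by 0.4748 s, uniformly in v.

    For the power divergence statistic put t = (n p q) ^ (-1/5), so that
    s ^ 2 = t ^ 5.  On the event W ^ 2 <= 1 / t the ratios U_j / (n p_j) lie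
    within t ^ 2 of 1, and a second-order expansion of the convex function
    that defines T_lambda shows that T_lambda / W ^ 2 lies within
    4 |lambda - 1| t ^ 2 of 1 ([power_divergence_sandwich]).  The complement
    of that event has probability at most 5 t by the first part and the
    Gaussian tail, and the chi-square distribution function changes by at
    most a multiple of |lambda - 1| t ^ 2 when its argument is rescaled by
    such a factor.  When C_1 and C_2 are 100 the claim is trivial unless
    t and (lambda - 1) ^ 2 t are small, and these errors then add up to at
    most (C_1 + C_2 (lambda - 1) ^ 2) t. *)

(** * Differentiation and monotonicity on segments *)

Section Calculus.
Variable R : realType.
Implicit Types (f g h : R -> R) (x a b : R).

Lemma is_deriveDf f g x a b : is_derive x 1 f a -> is_derive x 1 g b ->
  is_derive x 1 (fun t => f t + g t) (a + b).
Proof. exact: is_deriveD. Qed.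

Lemma is_deriveNf f x a : is_derive x 1 f a -> is_derive x 1 (fun t => - f t) (- a).
Proof. exact: is_deriveN. Qed.

Lemma is_deriveMf f g x a b : is_derive x 1 f a -> is_derive x 1 g b ->
  is_derive x 1 (fun t => f t * g t) (f x * b + g x * a).
Proof. exact: is_deriveM. Qed.

Lemma is_deriveXf f n x a : is_derive x 1 f a ->
  is_derive x 1 (fun t => f t ^+ n) (n%:R * f x ^+ n.-1 * a).
Proof.
move=> fa; have -> : (fun t => f t ^+ n) = f ^+ n.
  by apply/funext => t; rewrite exprfctE.
exact: is_deriveX.
Qed.

Lemma is_deriveVf f x a : f x != 0 -> is_derive x 1 f a ->
  is_derive x 1 (fun t => (f t)^-1) (- (f x ^- 2) * a).
Proof. by move=> f0 fa; exact: is_deriveV. Qed.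

Lemma is_derive_compf f g x a b : is_derive (g x) 1 f a -> is_derive x 1 g b ->
  is_derive x 1 (fun t => f (g t)) (a * b).
Proof. by move=> fa gb; exact: (@is_derive1_comp _ f g). Qed.

Lemma is_derive_cstf a x : is_derive x 1 (fun=> a) (0 : R).
Proof. exact: is_derive_cst. Qed.

Lemma is_derive_idf x : is_derive x 1 (fun t : R => t) (1 : R).
Proof. exact: is_derive_id. Qed.

End Calculus.

(** Instance search does not recognize sums and products that are written
    pointwise; these tactics build the derivative of an explicit expression
    from its syntax and leave the side conditions and the comparison with
    the expected derivative. *)
Ltac derive_step :=
  first [ exact (is_derive_cstf _ _) |
  lazymatch goal with
  | |- is_derive _ _ (fun t => t) _ => eapply is_derive_idf
  | |- is_derive _ _ (fun t => @?f t + @?g t) _ =>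
      eapply (@is_deriveDf _ f g); derive_step
  | |- is_derive _ _ (fun t => - @?f t) _ =>
      eapply (@is_deriveNf _ f); derive_step
  | |- is_derive _ _ (fun t => @?f t * @?g t) _ =>
      eapply (@is_deriveMf _ f g); derive_step
  | |- is_derive _ _ (fun t => @?f t ^+ ?n) _ =>
      eapply (@is_deriveXf _ f n); derive_step
  | |- is_derive _ _ (fun t => (@?f t)^-1) _ =>
      eapply (@is_deriveVf _ f); [| derive_step]
  | |- is_derive _ _ (fun t => expR (@?f t)) _ =>
      eapply (@is_derive_compf _ expR f); [exact (is_derive_expR _) | derive_step]
  | |- is_derive _ _ (fun t => ln (@?f t)) _ =>
      eapply (@is_derive_compf _ (@ln _) f); [eapply is_derive1_ln | derive_step]
  | |- is_derive _ _ (fun t => @?f t `^ ?a) _ =>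
      eapply (@is_derive_compf _ (fun y => y `^ a) f);
        [eapply is_derive1_powR | derive_step]
  | |- is_derive _ _ (fun t => Num.sqrt (@?f t)) _ =>
      eapply (@is_derive_compf _ Num.sqrt f); [eapply is_derive1_sqrt | derive_step]
  | |- is_derive _ _ (fun t => ?h (@?f t)) _ =>
      eapply (@is_derive_compf _ h f); [ | derive_step]
  | _ => idtac
  end].
Ltac derive_tac := eapply is_derive_eq; [derive_step|].

Section Monotone.
Variable R : realType.
Implicit Types (f df : R -> R) (x a b c : R).

Lemma is_derive_continuous f x a : is_derive x 1 f a -> {for x, continuous f}.
Proof.
by move=> fa; apply/differentiable_continuous/derivable1_diffP; exact: ex_derive.
Qed.

(** A constant rather than a bare product, so that instance search does not
    try to solve this hypothesis of the lemmas below. *)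
Definition deriv_on a b f df := forall x, a <= x <= b -> is_derive x 1 f (df x).

Lemma mean_value f df a b : a <= b -> deriv_on a b f df ->
  exists2 c, a <= c <= b & f b - f a = df c * (b - a).
Proof.
move=> ab fdf; have [c cab E] : exists2 c, c \in `[a, b] & f b - f a = df c * (b - a).
  apply: MVT_segment => // [x|].
    by rewrite in_itv/= => /andP[ax xb]; apply: fdf; rewrite !ltW.
  apply: derivable_within_continuous => x; rewrite in_itv /= => xab.
  by have := fdf x xab; move=> ?; exact: ex_derive.
by exists c => //; move: cab; rewrite in_itv.
Qed.

Lemma deriv_ge0_le f df a b : a <= b -> deriv_on a b f df ->
  (forall x, a <= x <= b -> 0 <= df x) -> f a <= f b.
Proof.
move=> ab fdf df0; have [c cab E] := mean_value ab fdf.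
by rewrite -subr_ge0 E mulr_ge0 ?df0 ?subr_ge0.
Qed.

Lemma deriv_le0_le f df a b : a <= b -> deriv_on a b f df ->
  (forall x, a <= x <= b -> df x <= 0) -> f b <= f a.
Proof.
move=> ab fdf df0; have [c cab E] := mean_value ab fdf.
by rewrite -subr_le0 E mulr_le0_ge0 ?df0 ?subr_ge0.
Qed.

Lemma deriv_ge0_ge0 f df b : 0 <= b -> f 0 = 0 -> deriv_on 0 b f df ->
  (forall x, 0 <= x <= b -> 0 <= df x) -> 0 <= f b.
Proof. by move=> b0 f0 fdf df0; rewrite -[leLHS]f0; exact: (deriv_ge0_le b0 fdf df0). Qed.
End Monotone.
Arguments deriv_ge0_le {R} f df {a b}.
Arguments deriv_le0_le {R} f df {a b}.
Arguments deriv_ge0_ge0 {R} f df {b}.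

(** * The standard normal distribution *)

Section Normal.
Variable R : realType.
Implicit Types x y z t : R.

Definition Phi x : R := fine (normal_prob 0 1 `]-oo, x]).
Definition phi x : R := normal_peak 1 * expR (- (x ^+ 2 / 2)).

Lemma normal_pdf_phi x : normal_pdf 0 1 x = phi x.
Proof.
by rewrite normal_pdfE ?oner_eq0 // /normal_fun /phi subr0 expr1n mulNr.
Qed.

Lemma is_derive_Phi x : is_derive x 1 Phi (phi x).
Proof.
have xx1 : x < x + 1 by rewrite ltrDl.
have int : lebesgue_measure.-integrable [set` Interval -oo%O (BRight (x + 1))]
   (EFin \o (normal_pdf 0 1 : R -> R)).
  apply: (integrableS _ _ (@subsetT _ _)) => //.
  exact: integrable_normal_pdf.
have [] := @continuous_FTC1 R (normal_pdf 0 1) -oo%O x (x + 1) xx1 int _ _.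
- by rewrite ltNyr.
- by move: (@continuous_normal_pdf R 0 1 (oner_neq0 _)); apply.
move=> d1 d2; rewrite -normal_pdf_phi -d2 derive1E; exact/derivableP.
Qed.

Lemma Phi_ge0 x : 0 <= Phi x.
Proof. exact: fine_ge0. Qed.

Lemma Phi_le1 x : Phi x <= 1.
Proof.
rewrite -lee_fin /Phi fineK ?probability_le1 //.
exact: fin_num_measure.
Qed.

Lemma normal_peak1_gt0 : 0 < normal_peak (1 : R).
Proof. exact: normal_peak_gt0 (oner_neq0 _). Qed.

Lemma phi_gt0 x : 0 < phi x.
Proof. by rewrite mulr_gt0 ?expR_gt0 ?normal_peak1_gt0. Qed.

Lemma Phi_cvg1 : Phi x @[x --> +oo] --> (1 : R).
Proof.
pose P : probability (measurableTypeR R) R := normal_prob (0:R) 1.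
have mid : measurable_fun setT (fun x : measurableTypeR R => x : R) by exact: measurable_id.
pose X : {RV P >-> R} := HB.pack_for {mfun measurableTypeR R >-> R} (fun x : R => x)
    (@isMeasurableFun.Build _ _ (measurableTypeR R) R _ mid).
by have := cvg_cdfy1 X => /fine_cvg.
Qed.

Lemma Phi_cvg0 : Phi x @[x --> -oo] --> (0 : R).
Proof.
pose P : probability (measurableTypeR R) R := normal_prob (0:R) 1.
have mid : measurable_fun setT (fun x : measurableTypeR R => x : R) by exact: measurable_id.
pose X : {RV P >-> R} := HB.pack_for {mfun measurableTypeR R >-> R} (fun x : R => x)
    (@isMeasurableFun.Build _ _ (measurableTypeR R) R _ mid).
by have := cvg_cdfNy0 X => /fine_cvg.
Qed.

Lemma Phi_mono x y : x <= y -> Phi x <= Phi y.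
Proof.
move=> xy; apply: (deriv_ge0_le Phi phi) => // z _; first exact: is_derive_Phi.
exact/ltW/phi_gt0.
Qed.

(** The derivative of Phi (- x) + Phi x vanishes because the density is
    even, and the sum tends to 1 at infinity. *)
Lemma PhiN x : Phi (- x) = 1 - Phi x.
Proof.
have cst a b : a <= b -> Phi (- a) + Phi a = Phi (- b) + Phi b.
  move=> ab.
  have D y : a <= y <= b -> is_derive y 1 (fun t => Phi (- t) + Phi t) 0.
    move=> _; derive_tac; [exact: is_derive_Phi|exact: is_derive_Phi|].
    by rewrite /phi sqrrN; ring.
  have [c _ E] := mean_value ab D.
  by apply/eqP; rewrite eq_sym -subr_eq0 E mul0r.
have cst0 a : Phi (- a) + Phi a = Phi (- 0) + Phi 0.
  case: (leP a 0) => [a0|/ltW a0]; last by rewrite -(cst _ _ a0).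
  exact: cst.
suff : Phi (- 0) + Phi 0 = 1 by move=> E; have := cst0 x; rewrite E => <-; ring.
have c1 : (fun t => Phi (- t) + Phi t) t @[t --> +oo] --> (0 + 1 : R).
  apply: cvgD; last exact: Phi_cvg1.
  by apply: (cvgNy_compNP (fun t => Phi t) _).1; exact: Phi_cvg0.
have c2 : (fun t => Phi (- t) + Phi t) t @[t --> +oo] --> (Phi (- 0) + Phi 0 : R).
  rewrite (_ : (fun t => _) = (fun=> Phi (- 0) + Phi 0)); first exact: cvg_cst.
  by apply/funext => t; exact: cst0.
by rewrite -[RHS]add0r; exact: (cvg_unique _ c2 c1).
Qed.

(** How the limit 1 at infinity enters the tail bounds. *)
Lemma Phi_sup_ge1 x M : (forall t, x <= t -> Phi t <= M) -> 1 <= M.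
Proof.
move=> H; rewrite leNgt; apply/negP => M1.
have /cvgr_gt/(_ M M1) [A [Ar HA]] := Phi_cvg1.
have := HA (Num.max (A + 1) x).
rewrite lt_max ltrDl ltr01 => /(_ isT); rewrite ltNge H //.
by rewrite le_max lexx orbT.
Qed.

Lemma is_derive_phi x : is_derive x 1 phi (- x * phi x).
Proof. by rewrite /phi; derive_tac; field. Qed.

(** The function Phi + phi / t has derivative - phi / t ^ 2, so it decreases
    to 1 on the positive half-line. *)
Lemma mills x : 0 < x -> 1 - Phi x <= phi x / x.
Proof.
move=> x0; rewrite lerBlDl; apply: (@Phi_sup_ge1 x) => t xt.
have t0 : 0 < t by exact: lt_le_trans xt.
apply: (@le_trans _ _ (Phi t + phi t / t)).
  by rewrite lerDl divr_ge0 ?ltW ?phi_gt0.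
apply: (deriv_le0_le (fun t => Phi t + phi t / t) (fun t => - phi t / t ^+ 2)) => // y /andP[xy _].
  have y0 : 0 < y by exact: lt_le_trans xy.
  derive_tac; [exact: is_derive_Phi|exact: is_derive_phi| by rewrite gt_eqF|].
  by field; rewrite gt_eqF.
by rewrite mulNr oppr_le0 divr_ge0 ?sqr_ge0 // ltW ?phi_gt0.
Qed.

Lemma phi_le_peak x : phi x <= normal_peak 1.
Proof.
rewrite /phi ler_piMr ?normal_peak_ge0 // -expR0 ler_expR oppr_le0.
by rewrite mulr_ge0 ?sqr_ge0.
Qed.

Lemma expR_ge_cubic x : 0 <= x -> 1 + x + x ^+ 2 / 2 + x ^+ 3 / 6 <= expR x.
Proof.
move=> x0.
have q y : 0 <= y -> 1 + y + y ^+ 2 / 2 <= expR y.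
  move=> y0; rewrite -subr_ge0.
  have := deriv_ge0_le (fun y => expR y - (1 + y + y ^+ 2 / 2)) (fun y => expR y - (1 + y)) y0.
  rewrite !expR0; have -> : 1 - (1 + 0 + 0 ^+ 2 / 2) = 0 :> R by field.
  apply=> z /andP[z0 _]; last by rewrite subr_ge0 expR_ge1Dx.
  by derive_tac; field.
rewrite -subr_ge0.
have := deriv_ge0_le (fun y => expR y - (1 + y + y ^+ 2 / 2 + y ^+ 3 / 6))
  (fun y => expR y - (1 + y + y ^+ 2 / 2)) x0.
rewrite !expR0; have -> : 1 - (1 + 0 + 0 ^+ 2 / 2 + 0 ^+ 3 / 6) = 0 :> R by field.
apply=> z /andP[z0 _]; last by rewrite subr_ge0 q.
by derive_tac; field.
Qed.

Lemma expRN1_le : expR (- 1) <= 37 / 100 :> R.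
Proof.
have h : expR 1 = expR (1 / 2) ^+ 2 :> R by rewrite -expRM_natr; congr expR; field.
have h0 : 0 <= 1 / 2 :> R by rewrite divr_ge0.
have e : 79 / 48 <= expR (1 / 2) :> R.
  apply: le_trans (expR_ge_cubic h0); lra.
have e1 : 100 / 37 <= expR 1 :> R by rewrite h; nra.
rewrite expRN -[leLHS]mul1r ler_pdivrMr ?expR_gt0 //; lra.
Qed.

Lemma expRN_le_quad x : 0 <= x -> expR (- x) <= (1 + x + x ^+ 2 / 2)^-1.
Proof.
move=> x0; have x3 : 0 <= x ^+ 3 / 6 by rewrite divr_ge0 ?exprn_ge0.
have x2 : 0 <= x ^+ 2 / 2 by rewrite divr_ge0 ?exprn_ge0.
rewrite expRN lef_pV2 ?posrE ?expR_gt0 //; last lra.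
have := expR_ge_cubic x0; lra.
Qed.

(** A chord of exp (- x) on [0, A], with the exponential replaced by its
    rational majorant so that the slope c can be checked by arithmetic. *)
Lemma expRN_le_lin A c x : 0 <= x <= A -> 0 <= c <= 1 ->
  c * A ^+ 2 <= 2 * (1 - c) + A * (1 - 2 * c) ->
  expR (- x) <= 1 - c * x.
Proof.
move=> /andP[x0 xA] /andP[c0 c1] hA; apply: le_trans (expRN_le_quad x0) _.
have d0 : 0 < 1 + x + x ^+ 2 / 2 by nra.
rewrite -[leLHS]mul1r ler_pdivrMr //.
have [xz|xp] := eqVneq x 0; first by rewrite xz; lra.
have {}xp : 0 < x by rewrite lt_def xp.
have A0 : 0 < A by lra.
have k : c * x ^+ 2 <= 2 * (1 - c) + x * (1 - 2 * c).
  rewrite -(ler_pM2l A0).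
  have : 0 <= (A - x) * (2 * (1 - c)) by rewrite mulr_ge0; lra.
  have : 0 <= c * A * x * (A - x) by rewrite !mulr_ge0; lra.
  by nra.
nra.
Qed.

(** The maximum of x exp (- x) is attained at 1. *)
Lemma mul_expRN_le x : x * expR (- x) <= expR (- 1).
Proof.
have -> : expR (- 1) = expR (x - 1) * expR (- x) by rewrite -expRD; congr expR; ring.
by rewrite ler_pM2r ?expR_gt0 //; have := expR_ge1Dx (x - 1); lra.
Qed.

(** The cosine is at least its Taylor polynomial of degree 6, which is still
    positive at 1.56, so its first zero lies beyond. The value 3.12 makes
    1.185 / sqrt (2 pi) smaller than 0.4748. *)
Lemma pi_ge312 : 312 / 100 <= pi :> R.
Proof.
have sin1 t : 0 <= t -> sin t <= t.
  move=> t0; rewrite -subr_ge0.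
  have := deriv_ge0_le (fun t => t - sin t) (fun t => 1 - cos t) t0.
  rewrite sin0 subr0; apply=> z _; last by rewrite subr_ge0 cos_le1.
  by derive_tac; [exact: is_derive_sin|ring].
have cos2 t : 0 <= t -> 1 - t ^+ 2 / 2 <= cos t.
  move=> t0; rewrite -subr_ge0.
  have := deriv_ge0_le (fun t => cos t - (1 - t ^+ 2 / 2)) (fun t => t - sin t) t0.
  rewrite cos0; have -> : 1 - (1 - 0 ^+ 2 / 2) = 0 :> R by field.
  apply=> z /andP[z0 _]; last by rewrite subr_ge0 sin1.
  by derive_tac; [exact: is_derive_cos|field].
have sin3 t : 0 <= t -> t - t ^+ 3 / 6 <= sin t.
  move=> t0; rewrite -subr_ge0.
  have := deriv_ge0_le (fun t => sin t - (t - t ^+ 3 / 6)) (fun t => cos t - (1 - t ^+ 2 / 2)) t0.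
  rewrite sin0; have -> : 0 - (0 - 0 ^+ 3 / 6) = 0 :> R by field.
  apply=> z /andP[z0 _]; last by rewrite subr_ge0 cos2.
  by derive_tac; [exact: is_derive_sin|field].
have cos4 t : 0 <= t -> cos t <= 1 - t ^+ 2 / 2 + t ^+ 4 / 24.
  move=> t0; rewrite -subr_ge0.
  have := deriv_ge0_le (fun t => 1 - t ^+ 2 / 2 + t ^+ 4 / 24 - cos t)
    (fun t => sin t - (t - t ^+ 3 / 6)) t0.
  rewrite cos0; have -> : 1 - 0 ^+ 2 / 2 + 0 ^+ 4 / 24 - 1 = 0 :> R by field.
  apply=> z /andP[z0 _]; last by rewrite subr_ge0 sin3.
  by derive_tac; [exact: is_derive_cos|field].
have sin5 t : 0 <= t -> sin t <= t - t ^+ 3 / 6 + t ^+ 5 / 120.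
  move=> t0; rewrite -subr_ge0.
  have := deriv_ge0_le (fun t => t - t ^+ 3 / 6 + t ^+ 5 / 120 - sin t)
    (fun t => 1 - t ^+ 2 / 2 + t ^+ 4 / 24 - cos t) t0.
  rewrite sin0; have -> : 0 - 0 ^+ 3 / 6 + 0 ^+ 5 / 120 - 0 = 0 :> R by field.
  apply=> z /andP[z0 _]; last by rewrite subr_ge0 cos4.
  by derive_tac; [exact: is_derive_sin|field].
have cos6 t : 0 <= t -> 1 - t ^+ 2 / 2 + t ^+ 4 / 24 - t ^+ 6 / 720 <= cos t.
  move=> t0; rewrite -subr_ge0.
  have := deriv_ge0_le (fun t => cos t - (1 - t ^+ 2 / 2 + t ^+ 4 / 24 - t ^+ 6 / 720))
    (fun t => t - t ^+ 3 / 6 + t ^+ 5 / 120 - sin t) t0.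
  rewrite cos0; have -> : 1 - (1 - 0 ^+ 2 / 2 + 0 ^+ 4 / 24 - 0 ^+ 6 / 720) = 0 :> R by field.
  apply=> z /andP[z0 _]; last by rewrite subr_ge0 sin5.
  by derive_tac; [exact: is_derive_cos|field].
rewrite leNgt; apply/negP => pi312.
have p0 := pihalf_ge1 R; have cp := cos_pihalf R.
(* At 39 / 25 the polynomial is about 0.00995, and it decreases there. *)
have yle : pi / 2 <= 39 / 25 :> R by lra.
move: (pi / 2 : R) yle p0 cp => y yle y1 cy.
have y0 : 0 <= y by lra.
have := cos6 y y0; rewrite cy.
have -> : y ^+ 4 = (y ^+ 2) ^+ 2 by ring.
have -> : y ^+ 6 = (y ^+ 2) ^+ 3 by ring.
have z1 : y ^+ 2 <= 244 / 100 by nra.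
have z0 : 0 <= y ^+ 2 by exact: sqr_ge0.
move: (y ^+ 2) z0 z1 => z z0 z1.
nra.
Qed.

Lemma normal_peak1_le : normal_peak 1 <= 4004 / 10000 :> R.
Proof.
have c0 := normal_peak1_gt0.
have E : normal_peak 1 ^+ 2 * (2 * pi) = 1 :> R.
  rewrite /normal_peak expr1n mul1r exprVn sqr_sqrtr; last first.
    by rewrite mulrn_wge0 // pi_ge0.
  by rewrite mulr_natl mulVf // gt_eqF // mulrn_wgt0 // pi_gt0.
have p := pi_ge312.
move: (normal_peak 1 : R) c0 E => c c0 E.
have h : c ^+ 2 * (624 / 100) <= 1.
  by rewrite -[leRHS]E; apply: ler_wpM2l; [exact: sqr_ge0|lra].
rewrite leNgt; apply/negP => h2; nra.
Qed.

Lemma normal_peak1_le1 : normal_peak 1 <= 1 :> R.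
Proof. have := normal_peak1_le; lra. Qed.

(** Mills for x > 1; for x <= 1 the right-hand side is at least 1 / 2. *)
Lemma one_minus_Phi_le x : 0 <= x -> 1 - Phi x <= expR (- (x ^+ 2 / 2)).
Proof.
move=> x0; have [x1|x1] := leP x 1; last first.
  apply: (le_trans (mills _)); first lra.
  rewrite ler_pdivrMr; last lra.
  have E := expR_gt0 (- (x ^+ 2 / 2)).
  apply: (@le_trans _ _ (expR (- (x ^+ 2 / 2)))); last by nra.
  by rewrite /phi ler_piMl ?expR_ge0 // normal_peak1_le1.
have h : expR (- (1 / 2)) <= expR (- (x ^+ 2 / 2)) by rewrite ler_expR; nra.
have := expR_ge1Dx (- (1 / 2) : R).
have P2 : Phi 0 = 1 / 2 by have := PhiN 0; rewrite oppr0; lra.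
have := Phi_mono x0; lra.
Qed.

End Normal.
Arguments Phi {R}.
Arguments phi {R}.

(** * Bounds on the likelihood-ratio function *)

Section LogIneq.
Variable R : realType.
Implicit Types (u x a b D : R).

Lemma mul_ln1D_le x : 0 <= x -> (1 + x) * ln (1 + x) <= x + x ^+ 2 / 2.
Proof.
move=> x0; rewrite -subr_ge0.
apply: (deriv_ge0_ge0 (fun x => x + x ^+ 2 / 2 - (1 + x) * ln (1 + x))
  (fun x => x - ln (1 + x)) x0).
- by rewrite addr0 ln1; field.
- move=> z /andP[z0 _]; have ? : 0 < 1 + z by lra.
  by derive_tac => //; field; rewrite gt_eqF.
- by move=> z /andP[z0 _]; rewrite subr_ge0 le_ln1Dx //; lra.
Qed.

Lemma mul_ln1D_ge u : 0 <= u -> u + 3 * u ^+ 2 / (2 * (3 + u)) <= (1 + u) * ln (1 + u).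
Proof.
move=> u0; rewrite -subr_ge0.
apply: (deriv_ge0_ge0 (fun u => (1 + u) * ln (1 + u) - (u + 3 * u ^+ 2 / (2 * (3 + u))))
  (fun u => ln (1 + u) - 3 / 2 * (u ^+ 2 + 6 * u) / (3 + u) ^+ 2) u0).
- by rewrite addr0 ln1; field.
- move=> z /andP[z0 _]; have ? : 0 < 1 + z by lra.
  have ? : 2 * (3 + z) != 0 by rewrite gt_eqF //; lra.
  derive_tac => //; field; rewrite !gt_eqF //; lra.
move=> t /andP[t0 _].
apply: (deriv_ge0_ge0 (fun u => ln (1 + u) - 3 / 2 * (u ^+ 2 + 6 * u) / (3 + u) ^+ 2)
  (fun u => (1 + u)^-1 - 27 / (3 + u) ^+ 3) t0).
- by rewrite addr0 ln1; field.
- move=> z /andP[z0 _]; have ? : 0 < 1 + z by lra.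
  have z3 : 3 + z != 0 by rewrite gt_eqF //; lra.
  have ? : (3 + z) ^+ 2 != 0 by rewrite expf_neq0.
  derive_tac => //; field; rewrite z3 gt_eqF //; lra.
move=> z /andP[z0 _]; have ? : 0 < 1 + z by lra.
rewrite subr_ge0 ler_pdivrMr ?exprn_gt0 //; last lra.
rewrite mulrC ler_pdivlMr //; nra.
Qed.

Lemma mul_ln1B_ge u : 0 <= u < 1 -> u ^+ 2 / 2 - u <= (1 - u) * ln (1 - u).
Proof.
move=> /andP[u0 u1]; rewrite -subr_ge0.
apply: (deriv_ge0_ge0 (fun u => (1 - u) * ln (1 - u) - (u ^+ 2 / 2 - u))
  (fun u : R => - ln (1 - u) - u) u0).
- by rewrite subr0 ln1; field.
- move=> z /andP[z0 zu]; have ? : 0 < 1 - z by lra.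
  by derive_tac => //; field; rewrite gt_eqF.
- move=> z /andP[z0 zu]; have := @le_ln1Dx R (- z); lra.
Qed.

Lemma mul_ln1B_le u : 0 <= u <= 1 ->
  (1 - u) * ln (1 - u) <= - u + u ^+ 2 / 2 + u ^+ 3 / 6 + u ^+ 4 / 3.
Proof.
move=> /andP[u0]; rewrite le_eqVlt => /predU1P[->|u1].
  by rewrite subrr mul0r; lra.
have : 0 <= - ln (1 - u) - (u + u ^+ 2 / 2 + u ^+ 3 / 3).
  apply: (deriv_ge0_ge0 (fun u : R => - ln (1 - u) - (u + u ^+ 2 / 2 + u ^+ 3 / 3))
    (fun u => u ^+ 3 / (1 - u)) u0).
  - by rewrite subr0 ln1; field.
  - move=> z /andP[z0 zu]; have ? : 0 < 1 - z by lra.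
    by derive_tac => //; field; rewrite gt_eqF.
  - by move=> z /andP[z0 zu]; rewrite divr_ge0 ?exprn_ge0 //; lra.
nra.
Qed.

(** A Bernstein-type lower bound for twice the log-likelihood ratio at
    distance D below the mean, a and b being the two expected counts. *)
Lemma divergence_ge a b D : 0 < a -> 0 < b -> 0 <= D < a ->
  D ^+ 2 / a + D ^+ 2 / (b * (1 + D / (3 * b))) <=
  2 * ((a - D) * ln (1 - D / a) + (b + D) * ln (1 + D / b)).
Proof.
move=> a0 b0 /andP[D0 Da].
have u0 : 0 <= D / a < 1.
  by rewrite ltr_pdivrMr // mul1r Da andbT divr_ge0 // ltW.
have w0 : 0 <= D / b by rewrite divr_ge0 // ltW.
have := ler_wpM2l (ltW a0) (mul_ln1B_ge u0).
have -> : a * ((1 - D / a) * ln (1 - D / a)) = (a - D) * ln (1 - D / a).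
  by field; rewrite gt_eqF.
have -> : a * ((D / a) ^+ 2 / 2 - D / a) = D ^+ 2 / a / 2 - D by field; rewrite gt_eqF.
have := ler_wpM2l (ltW b0) (mul_ln1D_ge w0).
have -> : b * ((1 + D / b) * ln (1 + D / b)) = (b + D) * ln (1 + D / b).
  by field; rewrite gt_eqF.
have -> : b * (D / b + 3 * (D / b) ^+ 2 / (2 * (3 + D / b))) =
   D + D ^+ 2 / (b * (1 + D / (3 * b))) / 2.
  by field; rewrite !gt_eqF //; nra.
lra.
Qed.

(** The companion above the mean. The range includes D = b, the last
    possible value of the count, where the term of the second cell vanishes. *)
Lemma divergence_le a b D : 0 < a -> 0 < b -> 0 <= D <= b ->
  2 * ((a + D) * ln (1 + D / a) + (b - D) * ln (1 - D / b)) <=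
  D ^+ 2 / a + D ^+ 2 / b * (1 + (D / b) / 3 + 2 * (D / b) ^+ 2 / 3).
Proof.
move=> a0 b0 /andP[D0 Da].
have u0 : 0 <= D / b <= 1.
  by rewrite ler_pdivrMr // mul1r Da andbT divr_ge0 // ltW.
have w0 : 0 <= D / a by rewrite divr_ge0 // ltW.
have := ler_wpM2l (ltW b0) (mul_ln1B_le u0).
have -> : b * ((1 - D / b) * ln (1 - D / b)) = (b - D) * ln (1 - D / b).
  by field; rewrite gt_eqF.
have := ler_wpM2l (ltW a0) (mul_ln1D_le w0).
have -> : a * ((1 + D / a) * ln (1 + D / a)) = (a + D) * ln (1 + D / a).
  by field; rewrite gt_eqF.
have -> : a * (D / a + (D / a) ^+ 2 / 2) = D + D ^+ 2 / a / 2 by field; rewrite gt_eqF.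
have -> : b * (- (D / b) + (D / b) ^+ 2 / 2 + (D / b) ^+ 3 / 6 + (D / b) ^+ 4 / 3) =
  - D + D ^+ 2 / b * (1 + (D / b) / 3 + 2 * (D / b) ^+ 2 / 3) / 2.
  by field; rewrite gt_eqF.
lra.
Qed.

End LogIneq.

(** * Normal probabilities of short intervals *)

Section NormalIneq.
Variable R : realType.
Implicit Types (v s r x y t : R).
Local Notation c := (normal_peak (1 : R)).

Lemma Phi_diff_le x y M : x <= y -> (forall t, x <= t <= y -> phi t <= M) ->
  Phi y - Phi x <= M * (y - x).
Proof.
move=> xy H.
have D : deriv_on x y Phi phi by move=> t _; exact: is_derive_Phi.
have [t txy ->] := mean_value xy D.
by rewrite ler_wpM2r ?subr_ge0 ?H.
Qed.

Lemma phi_anti x y : 0 <= x <= y -> phi y <= phi x.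
Proof.
move=> /andP[x0 xy]; rewrite /phi ler_wpM2l ?normal_peak_ge0 // ler_expR.
by rewrite lerN2 ler_pM2r ?invr_gt0 // ler_sqr ?nnegrE //; lra.
Qed.

Lemma Phi_diff_le_peak x y : x <= y -> Phi y - Phi x <= c * (y - x).
Proof. by move=> xy; apply: Phi_diff_le => // t _; exact: phi_le_peak. Qed.

Lemma Phi_diff_le_phi x y : 0 <= x <= y -> Phi y - Phi x <= phi x * (y - x).
Proof.
move=> /andP[x0 xy]; apply: Phi_diff_le => // t /andP[xt _].
by apply: phi_anti; rewrite x0.
Qed.

Lemma sqr_mul_expRN_le x : x ^+ 2 * expR (- (x ^+ 2 / 2)) <= 74 / 100.
Proof.
have := mul_expRN_le (x ^+ 2 / 2); have := expRN1_le R.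
set E := expR (- (x ^+ 2 / 2)); lra.
Qed.

(** If v s <= 3 / 2, the step from v to v + s costs at most c s, c being the
    peak of the density, and the step from r to v costs phi r (v - r), where
    v - r is at most r (v s) / 6 and r ^ 2 exp (- r ^ 2 / 2) is bounded. If
    v s is larger, then r s >= 1 and the Mills bound c / r for the whole
    tail is already below c s. *)
Lemma left_tail_ineq v s r : 0 <= v -> 0 < s -> 0 < r ->
  v ^+ 2 <= r ^+ 2 * (1 + v * s / 3) ->
  Phi (v + s) - Phi r <= 4748 / 10000 * s.
Proof.
move=> v0 s0 r0 H.
have cs : 0 < c * s by rewrite mulr_gt0 // normal_peak1_gt0.
suff K : Phi (v + s) - Phi r <= c * s * (116 / 100).
  by have := ler_wpM2r (ltW s0) (normal_peak1_le R); lra.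
have [xs|xb] := leP (v * s) (3 / 2); last first.
  have rs : 1 <= r * s.
    have e : v ^+ 2 * s ^+ 2 <= r ^+ 2 * s ^+ 2 * (1 + v * s / 3).
      by rewrite [leRHS]mulrAC; apply: ler_wpM2r => //; exact: sqr_ge0.
    have rs0 : 0 < r * s by rewrite mulr_gt0.
    rewrite leNgt; apply/negP => h; rewrite -!exprMn in e.
    have h1 : (r * s) ^+ 2 <= 1 by rewrite exprn_ile1 // ltW.
    move: (v * s) xb e => x xb e.
    have : x ^+ 2 <= 1 + x / 3.
      by apply: le_trans e _; rewrite ler_piMl //; lra.
    nra.
  have h : phi r / r <= c * s.
    rewrite ler_pdivrMr // -mulrA [s * r]mulrC.
    by apply: le_trans (phi_le_peak r) _; rewrite ler_peMr // normal_peak_ge0.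
  by have := Phi_le1 (v + s); have := mills r0; lra.
have d1 : Phi (v + s) - Phi v <= c * s.
  have vs : v <= v + s by rewrite lerDl ltW.
  by have := Phi_diff_le_peak vs; rewrite addrAC subrr add0r.
have [rv|vr] := leP v r.
  by have := Phi_mono rv; lra.
have d2 : Phi v - Phi r <= phi r * (v - r) by apply: Phi_diff_le_phi; rewrite !ltW.
have vs0 : 0 <= v * s by rewrite mulr_ge0 // ltW.
have vr' : v <= r * (1 + v * s / 6).
  have f0 : 0 <= 1 + v * s / 6 by lra.
  rewrite -ler_sqr ?nnegrE //; last by rewrite mulr_ge0 // ltW.
  rewrite exprMn; apply: le_trans H _; apply: ler_wpM2l; first exact: sqr_ge0.
  by move: (v * s) => x; have := sqr_ge0 x; lra.
have h1 : v - r <= r ^+ 2 * s * (5 / 24).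
  have k : r * (v * s / 6) <= r * (r * (5 / 4) * s / 6).
    apply: ler_wpM2l; [exact: ltW|apply: ler_wpM2r; [by rewrite invr_ge0|]].
    apply: ler_wpM2r; [exact: ltW|apply: le_trans vr' _].
    by apply: ler_wpM2l; [exact: ltW|lra].
  by move: vr' k; rewrite mulrDr mulr1; lra.
have h2 := sqr_mul_expRN_le r.
have h3 : phi r * (v - r) <= c * s * (16 / 100).
  apply: (@le_trans _ _ (phi r * (r ^+ 2 * s * (5 / 24)))).
    by apply: ler_wpM2l => //; exact/ltW/phi_gt0.
  rewrite /phi; move: (expR _) h2 => e h2.
  have -> : c * e * (r ^+ 2 * s * (5 / 24)) = c * s * (r ^+ 2 * e * (5 / 24)) by ring.
  by apply: ler_wpM2l; [exact: ltW|lra].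
lra.
Qed.

(** Here C is the slope of a chord bound for the exponential; integrating it
    gives a cubic majorant of the increment. *)
Lemma Phi_diff_le_quad C A x y : 0 <= C -> `|x| <= A -> `|y| <= A -> x <= y ->
  (forall t, 0 <= t <= A ^+ 2 / 2 -> expR (- t) <= 1 - C * t) ->
  Phi y - Phi x <= c * ((y - x) * (1 - C / 6 * (y ^+ 2 + x * y + x ^+ 2))).
Proof.
move=> C0 xA yA xy H.
have c0 := normal_peak1_gt0 R.
have : 0 <= (fun t => c * (t - C / 6 * t ^+ 3) - Phi t) y -
            (fun t => c * (t - C / 6 * t ^+ 3) - Phi t) x.
  rewrite subr_ge0.
  apply: (deriv_ge0_le (fun t => c * (t - C / 6 * t ^+ 3) - Phi t)
           (fun t => c * (1 - C * (t ^+ 2 / 2)) - phi t) xy).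
    by move=> t _; derive_tac; [exact: is_derive_Phi|field].
  move=> t /andP[xt ty]; rewrite subr_ge0 /phi ler_pM2l //; apply: H.
  apply/andP; split; first by rewrite mulr_ge0 ?sqr_ge0.
  have A0 : 0 <= A by exact: le_trans xA.
  rewrite ler_pM2r ?invr_gt0 // -(real_normK (num_real t)) ler_sqr ?nnegrE //.
  move: xA yA; rewrite !ler_norml => /andP[? ?] /andP[? ?].
  by apply/andP; split; lra.
have -> : (y - x) * (1 - C / 6 * (y ^+ 2 + x * y + x ^+ 2)) =
  (y - C / 6 * y ^+ 3) - (x - C / 6 * x ^+ 3) by ring.
rewrite /=; lra.
Qed.

(** The slopes 7 / 10 and 52 / 100 are close to the largest that the
    criterion of [expRN_le_lin] allows on the two ranges. *)
Lemma expRN_le_near t : 0 <= t <= 135 / 200 -> expR (- t) <= 1 - 7 / 10 * t :> R.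
Proof. by move=> t0; apply: (expRN_le_lin t0); lra. Qed.

Lemma expRN_le_mid t : 0 <= t <= 256 / 200 -> expR (- t) <= 1 - 52 / 100 * t :> R.
Proof. by move=> t0; apply: (expRN_le_lin t0); lra. Qed.

Lemma Phi_window_le C V v s : 0 <= v -> 0 < s -> 0 <= C -> v ^+ 2 <= V -> s ^+ 2 <= V ->
  (forall t, 0 <= t <= V / 2 -> expR (- t) <= 1 - C * t) ->
  Phi v - Phi (v - s) <= c * s * (1 - C / 2 * (v ^+ 2 - v * s + s ^+ 2 / 3)).
Proof.
move=> v0 s0 C0 vV sV H.
have V0 : 0 <= V by exact: le_trans (sqr_ge0 _) vV.
have vs : v - s <= v by lra.
have nle x : x ^+ 2 <= V -> `|x| <= Num.sqrt V by move=> xV; rewrite -sqrtr_sqr ler_wsqrtr.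
have h1 : (v - s) ^+ 2 <= V.
  have [?|?] := leP v s; nra.
have := @Phi_diff_le_quad C _ _ _ C0 (nle _ h1) (nle _ vV) vs.
rewrite sqr_sqrtr // => /(_ H).
have -> : v - (v - s) = s by ring.
by rewrite mulrA; have -> : C / 6 * (v ^+ 2 + (v - s) * v + (v - s) ^+ 2) =
  C / 2 * (v ^+ 2 - v * s + s ^+ 2 / 3) by field.
Qed.

(** The left-hand side is, relative to c s, the sum of the chord bound for
    the step of length s and of the error 0.42 v ^ 2 exp (- v ^ 2 / 2), with
    the chord in place of the exponential; the bound 1.185 makes the total
    less than 0.4748 s. *)
Lemma window_near v s : 0 <= v -> v ^+ 2 <= 135 / 100 -> 0 < s <= 1054 / 1000 ->
  1 - 7 / 20 * (v ^+ 2 - v * s + s ^+ 2 / 3) +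
  42 / 100 * (v ^+ 2 * (1 - 7 / 10 * (v ^+ 2 / 2))) <= 1185 / 1000.
Proof.
move=> v0 V /andP[s0 s1]; have vA : v <= 117 / 100 by nra.
(* The bracket is concave in s with maximum at s = 3 v / 2, which is
   admissible for small v; for larger v the endpoint s = 1.054 is the worst
   case. *)
have [v9|v9] := leP v (9 / 10).
  have := sqr_ge0 (3 / 2 * v - s).
  have : v ^+ 2 <= 81 / 100 by nra.
  have := sqr_ge0 v.
  rewrite (_ : (3 / 2 * v - s) ^+ 2 = 9 / 4 * v ^+ 2 - 3 * (v * s) + s ^+ 2); last by field.
  clear; move: (v ^+ 2) (v * s) (s ^+ 2) => V1 V2 V3.
  have := sqr_ge0 (V1 - 4 / 5); lra.
have : 0 <= (1054 / 1000 - s) * (3 * v - 1054 / 1000 - s) by apply: mulr_ge0; lra.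
(* These squares replace v ^ 4 by its tangent at v ^ 2 = 9 / 10 and complete
   the quadratic in v that remains. *)
have := sqr_ge0 (v ^+ 2 - 9 / 10); have := sqr_ge0 (v - 948 / 1000).
have -> : v ^+ 2 * (1 - 7 / 10 * (v ^+ 2 / 2)) = v ^+ 2 - 35 / 100 * (v ^+ 2 - 9 / 10) ^+ 2
  - 35 / 100 * (9 / 5 * v ^+ 2 - 81 / 100) by field.
lra.
Qed.

Lemma window_mid v s : 0 <= v -> 135 / 100 <= v ^+ 2 -> 0 < s <= 1054 / 1000 ->
  1 - 26 / 100 * (v ^+ 2 - v * s + s ^+ 2 / 3) + 42 / 100 * (74 / 100) <= 1185 / 1000.
Proof.
move=> v0 V /andP[s0 s1]; have vA : 116 / 100 <= v by nra.
nra.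
Qed.

(** The increment splits at v: the part above v is at most 0.42 v ^ 2 s phi
    v, and the part below is bounded by a chord of the density when v ^ 2 <=
    2.56 and by its largest value when v is larger. The two extremes occur
    at different v, which is what leaves room below 0.4748 s. *)
Lemma right_tail_ineq v s r : 0 <= v -> 0 < s <= 1054 / 1000 -> 0 <= r ->
  r <= v + 42 / 100 * v ^+ 2 * s ->
  Phi r - Phi (v - s) <= 4748 / 10000 * s.
Proof.
move=> v0 /andP[s0 s1] r0 H.
have c0 := normal_peak1_gt0 R.
have cs : 0 < c * s by rewrite mulr_gt0.
have e0 := expR_ge0 (- (v ^+ 2 / 2)).
pose e := 42 / 100 * (v ^+ 2 * expR (- (v ^+ 2 / 2))).
have e_ge0 : 0 <= e by rewrite !mulr_ge0 ?sqr_ge0.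
suff K : (Phi v - Phi (v - s)) + c * s * e <= c * s * (1185 / 1000).
  have d : Phi r - Phi v <= c * s * e.
    have [rv|/ltW vr] := leP r v.
      by apply: (@le_trans _ _ 0); rewrite ?subr_le0 ?Phi_mono // mulr_ge0 // ltW.
    have := @Phi_diff_le_phi v r; rewrite v0 vr => /(_ isT) h.
    apply: le_trans h _.
    have -> : c * s * e = phi v * (42 / 100 * v ^+ 2 * s) by rewrite /phi /e; ring.
    by apply: ler_wpM2l; [exact/ltW/phi_gt0|rewrite lerBlDl].
  have : c * s * (1185 / 1000) <= 4748 / 10000 * s.
    have := normal_peak1_le R; clear -s0; move=> c1.
    have : c * s <= 4004 / 10000 * s by rewrite ler_pM2r.
    lra.
  clear -K d; lra.
have E2 : v ^+ 2 * expR (- (v ^+ 2 / 2)) <= 74 / 100 by exact: sqr_mul_expRN_le.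
have e_le : e <= 42 / 100 * (74 / 100) by apply: ler_wpM2l E2; clear; lra.
have s2 : s ^+ 2 <= 135 / 100 by clear -s0 s1; nra.
have h (F : R) : Phi v - Phi (v - s) <= c * s * F -> F + e <= 1185 / 1000 ->
    Phi v - Phi (v - s) + c * s * e <= c * s * (1185 / 1000).
  move=> hF hFe; apply: le_trans (lerD hF (lexx _)) _.
  by rewrite -mulrDr ler_pM2l.
(* The thresholds 1.35 and 2.56 for v ^ 2 make each of the three bounds fall
   below 1.185. *)
have [V1|/ltW V1] := leP (v ^+ 2) (135 / 100).
  apply: h.
    apply: (Phi_window_le v0 s0 (C := 7 / 10) _ V1 s2); first by clear; lra.
    by move=> t ht; apply: expRN_le_near; move: ht; clear; lra.
  have e1 : e <= 42 / 100 * (v ^+ 2 * (1 - 7 / 10 * (v ^+ 2 / 2))).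
    apply: ler_wpM2l; first by clear; lra.
    apply: ler_wpM2l; first exact: sqr_ge0.
    by apply: expRN_le_near; move: V1 (sqr_ge0 v); clear; lra.
  have := window_near v0 V1; move/(_ s); rewrite s0 s1 => /(_ isT).
  by move: e1; clear; lra.
have [V2|/ltW V2] := leP (v ^+ 2) (256 / 100).
  apply: h.
    apply: (Phi_window_le v0 s0 (C := 52 / 100) _ V2 _); first by clear; lra.
      by move: s2; clear; lra.
    by move=> t ht; apply: expRN_le_mid; move: ht; clear; lra.
  have := window_mid v0 V1; move/(_ s); rewrite s0 s1 => /(_ isT).
  by move: e_le; clear; lra.
have v1 : 16 / 10 <= v by clear -V2 v0; nra.
apply: (h (expR (- ((v - s) ^+ 2 / 2)))).
  have vsv : 0 <= v - s <= v by clear -v1 s0 s1; apply/andP; split; lra.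
  have := Phi_diff_le_phi vsv; rewrite /phi.
  by have -> : v - (v - s) = s by [ring]; rewrite mulrAC.
have : expR (- ((v - s) ^+ 2 / 2)) <= 1 - 92 / 100 * (145 / 1000).
  apply: (@le_trans _ _ (expR (- (145 / 1000)))).
    by rewrite ler_expR lerN2; clear -v1 s1; nra.
  by apply: (@expRN_le_lin _ (145 / 1000)); clear; lra.
by move: e_le; clear; lra.
Qed.
End NormalIneq.

(** * Functions whose derivative changes sign once *)

Section SignChange.
Variable R : realType.
Implicit Types (f df h : R -> R) (a b p s t x : R).

Lemma mean_value_open f df a b : a < b ->
  (forall x, a <= x <= b -> {for x, continuous f}) ->
  (forall x, a < x < b -> is_derive x 1 f (df x)) ->
  exists2 c, a < c < b & f b - f a = df c * (b - a).
Proof.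
move=> ab cf fdf; have [c cab E] : exists2 c, c \in `]a, b[ & f b - f a = df c * (b - a).
  have fdf' x : x \in `]a, b[ -> is_derive x 1 f (df x) by rewrite in_itv/=; exact: fdf.
  apply: (MVT ab fdf').
  apply: continuous_in_subspaceT => x; rewrite inE /= in_itv /=; exact: cf.
by exists c => //; move: cab; rewrite in_itv.
Qed.

(** If f is negative at p, its derivative is nonpositive from p on: by
    assumption, or because f has decreased on the way from its nonnegative
    start and the derivative does not become positive again. Then f stays
    below f p, contrary to the lower bound - h, which tends to 0 at b. *)
Lemma single_sign_change_ge0 f df h a b : a < b ->
  (forall t, a <= t < b -> {for t, continuous f}) ->
  (forall t, a < t < b -> is_derive t 1 f (df t)) ->
  (forall s t, a < s -> s <= t -> t < b -> df s < 0 -> df t <= 0) ->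
  {for b, continuous h} -> h b = 0 -> (forall t, a < t < b -> - h t <= f t) ->
  (0 <= f a \/ forall t, a < t < b -> df t <= 0) ->
  forall p, a <= p < b -> 0 <= f p.
Proof.
move=> ab cf fdf sgn ch hb hf start p /andP[ap pb].
rewrite leNgt; apply/negP => fp.
have decr t : p < t < b -> df t <= 0.
  move=> /andP[pt tb]; case: start => [fa|]; last by apply; rewrite tb (le_lt_trans ap pt).
  have {}ap : a < p.
    by rewrite lt_def ap andbT; apply/eqP => E; move: fp; rewrite E ltNge fa.
  have [|x xap|s /andP[as_ sp] E] := @mean_value_open f df a p ap.
  - by move=> x /andP[ax xp]; apply: cf; rewrite ax (le_lt_trans xp pb).
  - by move: xap => /andP[ax xp]; apply: fdf; rewrite ax (lt_trans xp pb).
  apply: (sgn s) => //; first by rewrite ltW // (lt_trans sp).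
  rewrite ltNge; apply/negP => ds.
  have : 0 <= f p - f a by rewrite E mulr_ge0 // subr_ge0 ltW.
  by rewrite subr_ge0 leNgt (lt_le_trans fp).
have [v /andP[pv vb] hv] : exists2 v, p < v < b & h v < - f p.
  have : h b < - f p by rewrite hb oppr_gt0.
  move=> hlt; have /= nb := cvgr_lt _ ch _ hlt.
  have nl : \forall t \near b^'-, h t < - f p by apply: cvg_within; exact: nb.
  near b^'- => v; exists v; last by near: v.
  by apply/andP; split; near: v; [exact: nbhs_left_gt|exact: nbhs_left_lt].
have fv : f p < f v.
  have av : a < v < b by rewrite vb (le_lt_trans ap pv).
  by have := hf v av; apply: lt_le_trans; rewrite ltrNr.
have [|x xpv|s /andP[ps sv] E] := @mean_value_open f df p v pv.
- by move=> x /andP[px xv]; apply: cf; rewrite (le_trans ap px) (le_lt_trans xv vb).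
- by move: xpv => /andP[px xv]; apply: fdf; rewrite (le_lt_trans ap px) (lt_trans xv vb).
move: fv; rewrite -subr_gt0 E ltNge mulr_le0_ge0 //; last by rewrite subr_ge0 ltW.
by apply: decr; rewrite ps (lt_trans sv vb).
Unshelve. all: by end_near. Qed.

End SignChange.

(** * The Kullback-Leibler divergence of two Bernoulli laws *)

Section Entropy.
Variable R : realType.
Implicit Types (p x t : R).

Definition kl x p : R := x * (ln x - ln p) + (1 - x) * (ln (1 - x) - ln (1 - p)).

Lemma is_derive_kl x p : 0 < p < 1 -> is_derive p 1 (kl x) ((p - x) / (p * (1 - p))).
Proof.
move=> /andP[p0 p1]; have q0 : 0 < 1 - p by rewrite subr_gt0.
by rewrite /kl; derive_tac => //; field; rewrite !gt_eqF.
Qed.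

Lemma klxx x : kl x x = 0.
Proof. by rewrite /kl !subrr !mulr0 addr0. Qed.

(** Up to a positive factor, the derivative of [kl_ratio] in p has the sign
    of this function for p < x and the opposite sign for p > x; it increases
    through its zero at x. *)
Definition kl_excess x p : R := 2 * (1 - x) * kl x p - (x - p) ^+ 2 / p.

Lemma kl_excess_mono x s t : 0 < s -> s <= t -> t < 1 -> kl_excess x s <= kl_excess x t.
Proof.
move=> s0 st t1.
apply: (deriv_ge0_le (kl_excess x) (fun p => (x - p) ^+ 2 / p * (2 / (1 - p) + p^-1)) st).
  move=> p /andP[sp pt]; have p0 : 0 < p by exact: lt_le_trans sp.
  have q0 : 0 < 1 - p by rewrite subr_gt0 (le_lt_trans pt).
  rewrite /kl_excess; derive_tac.
  - by apply: is_derive_kl; rewrite p0 -subr_gt0.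
  - by rewrite gt_eqF.
  - by field; rewrite !gt_eqF.
move=> p /andP[sp pt]; have p0 : 0 < p by exact: lt_le_trans sp.
have q0 : 0 < 1 - p by rewrite subr_gt0 (le_lt_trans pt).
have pV : 0 <= p^-1 by rewrite invr_ge0 ltW.
have qV : 0 <= (1 - p)^-1 by rewrite invr_ge0 ltW.
apply: mulr_ge0; first exact: mulr_ge0 (sqr_ge0 _) pV.
by apply: addr_ge0 => //; exact: mulr_ge0.
Qed.

Lemma kl_excessxx x : kl_excess x x = 0.
Proof. by rewrite /kl_excess klxx subrr expr0n mulr0 mul0r subrr. Qed.

(** The divergence minus its second-order approximation at x, rescaled by (1
    - x) ^ 2 / (1 - p) ^ 2; its monotonicity compares [kl_ratio] with its
    value at x on both sides. *)
Definition kl_defect x p : R := kl x p - (x - p) ^+ 2 * (1 - x) / (2 * x * (1 - p) ^+ 2).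

Lemma kl_defect_mono x s t : 0 < x < 1 -> 0 < s -> s <= t -> t < 1 -> kl_defect x t <= kl_defect x s.
Proof.
move=> /andP[x0 x1] s0 st t1.
apply: (deriv_le0_le (kl_defect x)
  (fun p => - ((p - x) ^+ 2 * (1 - x * p)) / (p * x * (1 - p) ^+ 3)) st).
  move=> p /andP[sp pt]; have p0 : 0 < p by exact: lt_le_trans sp.
  have q0 : 0 < 1 - p by rewrite subr_gt0 (le_lt_trans pt).
  rewrite /kl_defect; derive_tac.
  - by apply: is_derive_kl; rewrite p0 -subr_gt0.
  - by rewrite !mulf_neq0 ?expf_neq0 ?gt_eqF.
  - by field; rewrite !gt_eqF.
move=> p /andP[sp pt]; have p0 : 0 < p by exact: lt_le_trans sp.
have q0 : 0 < 1 - p by rewrite subr_gt0 (le_lt_trans pt).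
rewrite mulNr oppr_le0; apply: divr_ge0; apply: mulr_ge0.
- exact: sqr_ge0.
- have -> : 1 - x * p = (1 - x) + x * (1 - p) by ring.
  by rewrite addr_ge0 ?mulr_ge0 // ?subr_ge0 ltW // -subr_gt0.
- by rewrite mulr_ge0 // ltW.
- by rewrite exprn_ge0 // ltW.
Qed.

Lemma kl_defectxx x : kl_defect x x = 0.
Proof. by rewrite /kl_defect klxx subrr expr0n !mul0r subrr. Qed.

Lemma kl_gt0 x p : 0 < x < 1 -> 0 < p < 1 -> p != x -> 0 < kl x p.
Proof.
move=> /andP[x0 x1] /andP[p0 p1]; rewrite neq_lt => /orP[px|xp].
  have : kl_defect x x <= kl_defect x p by apply: kl_defect_mono; rewrite ?x0 // ltW.
  rewrite kl_defectxx /kl_defect subr_ge0; apply: lt_le_trans.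
  by rewrite divr_gt0 ?mulr_gt0 ?exprn_gt0 // subr_gt0.
have : kl_excess x x <= kl_excess x p by apply: kl_excess_mono; rewrite // ltW.
rewrite kl_excessxx /kl_excess subr_ge0 => h.
have : 0 < 2 * (1 - x) * kl x p.
  apply: lt_le_trans h; rewrite divr_gt0 //; have : x - p < 0 by rewrite subr_lt0.
  by move=> ?; rewrite lt_def sqr_ge0 expf_neq0 ?lt_eqF.
by rewrite pmulr_rgt0 // mulr_gt0 // subr_gt0.
Qed.

Lemma kl_ge0 x p : 0 < x < 1 -> 0 < p < 1 -> 0 <= kl x p.
Proof.
move=> x01 p01; have [->|px] := eqVneq p x; first by rewrite klxx.
exact/ltW/kl_gt0.
Qed.

(** The derivative in p of the normal bound differs from that of the
    binomial probability through 1 / sqrt (kl_ratio). The expression is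
    singular at p = x, where it extends by (1 - x) / (2 x). *)
Definition kl_ratio x p : R := kl x p * ((1 - p) / (x - p)) ^+ 2.

Lemma is_derive_kl_ratio x p : 0 < p < 1 -> p != x ->
  is_derive p 1 (kl_ratio x) ((1 - p) / (x - p) ^+ 3 * kl_excess x p).
Proof.
move=> p01 px; have p0 : 0 < p by case/andP: p01.
have q0 : 0 < 1 - p by case/andP: p01 => _; rewrite subr_gt0.
have xp : x - p != 0 by rewrite subr_eq0 eq_sym.
rewrite /kl_ratio; derive_tac; [exact: is_derive_kl|by []|].
by rewrite /kl_excess; field; rewrite xp !gt_eqF.
Qed.

Lemma kl_ratio_left x s t : 0 < s -> s <= t -> t < x -> x < 1 -> kl_ratio x t <= kl_ratio x s.
Proof.
move=> s0 st tx x1.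
apply: (deriv_le0_le (kl_ratio x) (fun p => (1 - p) / (x - p) ^+ 3 * kl_excess x p) st).
  move=> p /andP[sp pt]; apply: is_derive_kl_ratio; last by rewrite lt_eqF // (le_lt_trans pt).
  by rewrite (lt_le_trans s0 sp) (le_lt_trans pt) // (lt_trans tx).
move=> p /andP[sp pt]; have px : p < x by exact: le_lt_trans tx.
rewrite mulr_ge0_le0 //.
  by rewrite divr_ge0 ?exprn_ge0 ?subr_ge0 ?ltW // (lt_trans px).
by rewrite -(kl_excessxx x); apply: kl_excess_mono => //; rewrite ?(lt_le_trans s0) // ltW.
Qed.

Lemma kl_ratio_right x s t : 0 < x -> x < s -> s <= t -> t < 1 -> kl_ratio x t <= kl_ratio x s.
Proof.
move=> x0 xs st t1.
apply: (deriv_le0_le (kl_ratio x) (fun p => (1 - p) / (x - p) ^+ 3 * kl_excess x p) st).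
  move=> p /andP[sp pt]; apply: is_derive_kl_ratio; last by rewrite gt_eqF // (lt_le_trans xs).
  by rewrite (lt_trans x0 (lt_le_trans xs sp)) (le_lt_trans pt).
move=> p /andP[sp pt]; have px : x < p by exact: lt_le_trans sp.
rewrite mulr_le0_ge0 //.
  rewrite mulr_ge0_le0 ?subr_ge0 ?(ltW (le_lt_trans pt _)) //.
  rewrite invr_le0 exprS mulr_le0_ge0 ?sqr_ge0 // subr_le0 ltW //.
by rewrite -(kl_excessxx x); apply: kl_excess_mono => //; rewrite ?(le_lt_trans pt) // ltW.
Qed.

Lemma kl_ratio_left_ge x p : 0 < p -> p < x -> x < 1 -> (1 - x) / (2 * x) <= kl_ratio x p.
Proof.
move=> p0 px x1; have x0 : 0 < x by exact: lt_trans px.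
have : kl_defect x x <= kl_defect x p by apply: kl_defect_mono; rewrite ?x0 // ltW.
rewrite kl_defectxx /kl_defect subr_ge0 /kl_ratio => h.
have := ler_wpM2r (sqr_ge0 ((1 - p) / (x - p))) h; apply: le_trans.
rewrite le_eqVlt; apply/orP; left; apply/eqP; field.
by rewrite !gt_eqF // subr_gt0 // (lt_trans px).
Qed.

Lemma kl_ratio_right_le x p : 0 < x -> x < p -> p < 1 -> kl_ratio x p <= (1 - x) / (2 * x).
Proof.
move=> x0 xp p1; have x1 : x < 1 by exact: lt_trans p1.
have : kl_defect x p <= kl_defect x x by apply: kl_defect_mono; rewrite ?x0 // ltW.
rewrite kl_defectxx /kl_defect subr_le0 /kl_ratio => h.
have := ler_wpM2r (sqr_ge0 ((1 - p) / (x - p))) h; move=> /le_trans; apply.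
have xp0 : x - p != 0 by rewrite lt_eqF // subr_lt0.
have q0 : 1 - p != 0 by rewrite gt_eqF // subr_gt0.
have x0' : x != 0 by rewrite gt_eqF.
by rewrite le_eqVlt; apply/orP; left; apply/eqP; field; rewrite xp0 q0 x0'.
Qed.

End Entropy.

(** * The binomial distribution function *)

Section BinomialCdf.
Variable R : realType.
Implicit Types (p : R) (n y : nat).

(** P (S < y) for S binomial with parameters n and p; counting the values
    below y makes the case of the empty sum available as y = 0. *)
Definition binom_lt n y p : R := \sum_(0 <= i < y) 'C(n, i)%:R * (p ^+ i * (1 - p) ^+ (n - i)).

(** The derivatives of consecutive terms telescope. *)
Lemma is_derive_binom_lt n y p : (y <= n)%N ->
  is_derive p 1 (binom_lt n y) (- (y%:R * 'C(n, y)%:R * (p ^+ y.-1 * (1 - p) ^+ (n - y)))).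
Proof.
elim: y => [_|y IH yn].
  rewrite mul0r mul0r oppr0 (_ : binom_lt n 0 = fun=> 0); first exact: is_derive_cst.
  by apply/funext => q; rewrite /binom_lt big_geq.
rewrite (_ : binom_lt n y.+1 = fun q => binom_lt n y q +
    'C(n, y)%:R * (q ^+ y * (1 - q) ^+ (n - y))); last first.
  by apply/funext => q; rewrite /binom_lt big_nat_recr.
derive_tac; [exact: IH (ltnW yn)|].
have -> : y.+1%:R * 'C(n, y.+1)%:R = (n - y)%:R * 'C(n, y)%:R :> R.
  by rewrite -!natrM mul_bin_left.
rewrite -subnS /=; case: y {IH yn} => [|y]; last by rewrite /=; ring.
by rewrite /= !expr0; ring.
Qed.

Lemma binom_lt_all n p : binom_lt n n.+1 p = 1.
Proof.
have : (1 - p + p) ^+ n = 1 by rewrite subrK expr1n.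
rewrite exprDn => <-; rewrite /binom_lt big_mkord; apply: eq_bigr => i _.
by rewrite mulr_natl; congr (_ *+ _); rewrite mulrC.
Qed.

Lemma binom_lt_le1 n y p : (y <= n.+1)%N -> 0 <= p <= 1 -> binom_lt n y p <= 1.
Proof.
move=> yn /andP[p0 p1]; rewrite -(binom_lt_all n p) /binom_lt.
rewrite [leRHS](big_cat_nat (n := y)) //= lerDl sumr_ge0 // => i _.
by rewrite !mulr_ge0 ?exprn_ge0 // subr_ge0.
Qed.

Lemma binom_lt_sym n y p : (y <= n.+1)%N -> binom_lt n y p = 1 - binom_lt n (n.+1 - y) (1 - p).
Proof.
move=> yn; apply/eqP; rewrite eq_sym subr_eq; apply/eqP.
rewrite -[LHS](binom_lt_all n p) /binom_lt (big_cat_nat (n := y)) //=; congr (_ + _).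
rewrite -{1}(add0n y) big_addn big_nat_rev /= [LHS]big_nat [RHS]big_nat.
apply: eq_bigr => i /andP[_ iy]; rewrite add0n.
have -> : (n.+1 - y - i.+1 + y = n - i)%N by lia.
have il : (i <= n)%N by lia.
by rewrite bin_sub // subKn // subKr [X in _ * X = _]mulrC.
Qed.

End BinomialCdf.

(** * Zubkov and Serov's inequality *)

Section ZubkovSerov.
Variable R : realType.
Implicit Types (p t : R).
Variables (n y : nat).
Hypothesis y0 : (0 < y)%N.
Hypothesis yn : (y < n)%N.
Variable x : R.
Hypothesis xE : x = y%:R / n%:R.
Let n0 : 0 < n%:R :> R. Proof. by rewrite ltr0n (leq_trans _ yn). Qed.
Let x01 : 0 < x < 1.
Proof.
rewrite xE; apply/andP; split; first by apply: divr_gt0 => //; rewrite ltr0n.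
by rewrite ltr_pdivrMr // mul1r ltr_nat.
Qed.
Let x0 : 0 < x. Proof. by case/andP: x01. Qed.
Let x1 : x < 1. Proof. by case/andP: x01. Qed.

(** The modulus of the signed root of the likelihood-ratio statistic. *)
Definition lrt p : R := Num.sqrt (2 * n%:R * kl x p).
Let Z : R := x ^+ y * (1 - x) ^+ (n - y).
Let Z0 : 0 < Z. Proof. by rewrite mulr_gt0 // exprn_gt0 // subr_gt0. Qed.

Let expR_lrt p : 0 < p < 1 -> expR (- (lrt p ^+ 2 / 2)) = p ^+ y * (1 - p) ^+ (n - y) / Z.
Proof.
move=> p01; have /andP[p0 p1] := p01.
have q0 : 0 < 1 - p by rewrite subr_gt0.
have xc0 : 0 < 1 - x by rewrite subr_gt0.
rewrite sqr_sqrtr; last by rewrite !mulr_ge0 ?kl_ge0 // ltW.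
have E (u : R) (k : nat) : 0 < u -> u ^+ k = expR (k%:R * ln u).
  by move=> u0; rewrite expRM_natl lnK.
rewrite /Z !E // -!expRD -expRB; congr expR.
have -> : (n - y)%:R = n%:R * (1 - x) :> R.
  by rewrite xE natrB ?(ltnW yn) //; field; rewrite gt_eqF.
have -> : y%:R = n%:R * x :> R by rewrite xE; field; rewrite gt_eqF.
by rewrite /kl; field.
Qed.

Let S p : R := Num.sqrt (2 * n%:R * kl_ratio x p).
Let K : R := normal_peak 1 * n%:R / Z.
(** The derivative of the difference on either side of x: the sign of the
    root cancels that of x - p. *)
Let df p : R := p ^+ y.-1 * (1 - p) ^+ (n - y) * (y%:R * 'C(n, y)%:R - K / S p).

Let lrt_gt0 p : 0 < p < 1 -> p != x -> 0 < lrt p.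
Proof. by move=> p01 px; rewrite sqrtr_gt0 !mulr_gt0 // kl_gt0. Qed.

Let S_lrt p : 0 < p < 1 -> p != x -> S p = lrt p * ((1 - p) / `|x - p|).
Proof.
move=> p01 px; have /andP[p0 p1] := p01; have q0 : 0 < 1 - p by rewrite subr_gt0.
rewrite /S /lrt /kl_ratio mulrA sqrtrM; last by rewrite !mulr_ge0 ?kl_ge0 // ltW.
by rewrite sqrtr_sqr normrM normrV ?unitfE ?subr_eq0 1?eq_sym // gtr0_norm.
Qed.

Let is_derive_lrt p : 0 < p < 1 -> p != x ->
  is_derive p 1 lrt (n%:R * (p - x) / (p * (1 - p)) / lrt p).
Proof.
move=> p01 px; have /andP[p0 p1] := p01; have q0 : 0 < 1 - p by rewrite subr_gt0.
have l0 := lrt_gt0 p01 px.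
have s0 : 0 < 2 * n%:R * kl x p by rewrite !mulr_gt0 // kl_gt0.
rewrite /lrt; derive_tac; [exact: s0|exact: is_derive_kl|].
by rewrite -/(lrt p); field; rewrite !gt_eqF.
Qed.

Let pow_pred p : p ^+ y = p * p ^+ y.-1.
Proof. by rewrite -exprS prednK. Qed.

Let is_derive_left p : 0 < p < x ->
  is_derive p 1 (fun p => Phi (lrt p) - binom_lt n y p) (df p).
Proof.
move=> /andP[p0 px]; have p1 : p < 1 by exact: lt_trans x1.
have p01 : 0 < p < 1 by rewrite p0.
have pnx : p != x by rewrite lt_eqF.
have q0 : 0 < 1 - p by rewrite subr_gt0.
have l0 := lrt_gt0 p01 pnx; have xp0 : 0 < x - p by rewrite subr_gt0.
derive_tac; [exact: is_derive_Phi|exact: is_derive_lrt|exact: is_derive_binom_lt (ltnW yn)|].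
rewrite /df S_lrt // /phi expR_lrt // pow_pred /K gtr0_norm //.
by field; rewrite !gt_eqF.
Qed.

Let is_derive_right p : x < p < 1 ->
  is_derive p 1 (fun p => Phi (- lrt p) - binom_lt n y p) (df p).
Proof.
move=> /andP[xp p1]; have p0 : 0 < p by exact: lt_trans xp.
have p01 : 0 < p < 1 by rewrite p0.
have pnx : p != x by rewrite gt_eqF.
have q0 : 0 < 1 - p by rewrite subr_gt0.
have l0 := lrt_gt0 p01 pnx; have xp0 : 0 < p - x by rewrite subr_gt0.
derive_tac; [exact: is_derive_Phi|exact: is_derive_lrt|exact: is_derive_binom_lt (ltnW yn)|].
rewrite /df S_lrt // /phi sqrrN expR_lrt // pow_pred /K distrC gtr0_norm //.
by field; rewrite !gt_eqF.
Qed.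

Let lrt_cont p : 0 < p < 1 -> {for p, continuous lrt}.
Proof.
move=> p01; have c1 : {for p, continuous (fun p => 2 * n%:R * kl x p)}.
  apply: (@continuousM _ _ (fun=> 2 * n%:R) (kl x)); first exact: cst_continuous.
  exact: is_derive_continuous (is_derive_kl x p01).
exact: (continuous_comp c1 (@sqrt_continuous R _)).
Qed.

Let Phi_cont t : {for t, continuous (Phi : R -> R)}.
Proof. exact: is_derive_continuous (is_derive_Phi t). Qed.

Let binom_cont p : {for p, continuous (binom_lt n y : R -> R)}.
Proof. exact: is_derive_continuous (is_derive_binom_lt _ (ltnW yn)). Qed.

Let left_cont p : 0 < p < 1 -> {for p, continuous (fun p => Phi (lrt p) - binom_lt n y p)}.
Proof.
move=> p01; apply: (@continuousB _ _ _ (fun p => Phi (lrt p))); last exact: binom_cont.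
by apply: (@continuous_comp _ _ _ lrt Phi); [exact: lrt_cont|exact: Phi_cont].
Qed.

Let right_cont p : 0 < p < 1 -> {for p, continuous (fun p => Phi (- lrt p) - binom_lt n y p)}.
Proof.
move=> p01; apply: (@continuousB _ _ _ (fun p => Phi (- lrt p))); last exact: binom_cont.
apply: (@continuous_comp _ _ _ (fun p => - lrt p) Phi); last exact: Phi_cont.
by apply: continuousN; exact: lrt_cont.
Qed.

Let df_le0 s t : 0 < s < 1 -> 0 < t < 1 -> 0 < kl_ratio x t -> kl_ratio x t <= kl_ratio x s ->
  df s <= 0 -> df t <= 0.
Proof.
move=> /andP[s0 s1] /andP[t0 t1] Nt Nst.
have Ps : 0 < s ^+ y.-1 * (1 - s) ^+ (n - y) by rewrite mulr_gt0 ?exprn_gt0 // subr_gt0.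
have Pt : 0 < t ^+ y.-1 * (1 - t) ^+ (n - y) by rewrite mulr_gt0 ?exprn_gt0 // subr_gt0.
rewrite /df !pmulr_rle0 // !subr_le0 => /le_trans; apply.
have K0 : 0 < K by rewrite divr_gt0 // mulr_gt0 // normal_peak1_gt0.
have n2 : 0 < 2 * n%:R :> R by rewrite mulr_gt0.
have St : 0 < S t by rewrite /S sqrtr_gt0; exact: mulr_gt0.
have Sts : S t <= S s by rewrite /S ler_wsqrtr // ler_pM2l.
have Ss : 0 < S s by exact: lt_le_trans St Sts.
by apply: ler_wpM2l; [exact: ltW|]; rewrite lef_pV2 ?posrE.
Qed.

Let df_ge0 s t : 0 < s < 1 -> 0 < t < 1 -> 0 < kl_ratio x t -> kl_ratio x t <= kl_ratio x s ->
  0 <= df t -> 0 <= df s.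
Proof.
move=> /andP[s0 s1] /andP[t0 t1] Nt Nst.
have Ps : 0 < s ^+ y.-1 * (1 - s) ^+ (n - y) by rewrite mulr_gt0 ?exprn_gt0 // subr_gt0.
have Pt : 0 < t ^+ y.-1 * (1 - t) ^+ (n - y) by rewrite mulr_gt0 ?exprn_gt0 // subr_gt0.
rewrite /df !pmulr_rge0 // !subr_ge0; apply: le_trans.
have K0 : 0 < K by rewrite divr_gt0 // mulr_gt0 // normal_peak1_gt0.
have n2 : 0 < 2 * n%:R :> R by rewrite mulr_gt0.
have St : 0 < S t by rewrite /S sqrtr_gt0; exact: mulr_gt0.
have Sts : S t <= S s by rewrite /S ler_wsqrtr // ler_pM2l.
have Ss : 0 < S s by exact: lt_le_trans St Sts.
by apply: ler_wpM2l; [exact: ltW|]; rewrite lef_pV2 ?posrE.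
Qed.

Let kl_ratio_gt0 p : 0 < p < 1 -> p != x -> 0 < kl_ratio x p.
Proof.
move=> p01 px; have /andP[p0 p1] := p01.
rewrite /kl_ratio mulr_gt0 ?kl_gt0 // lt_def sqr_ge0 andbT expf_neq0 // mulf_neq0 //.
  by rewrite gt_eqF // subr_gt0.
by rewrite invr_neq0 // subr_eq0 eq_sym.
Qed.

Let left_ge0 : (0 <= Phi (lrt x) - binom_lt n y x \/ (forall p, 0 < p < x -> 0 <= df p)) ->
  forall p, 0 < p <= x -> 0 <= Phi (lrt p) - binom_lt n y p.
Proof.
move=> start p /andP[p0 px].
have x0' : - x < 0 by rewrite oppr_lt0.
(* The reflection t = - p turns the end p = 0 into a right end; there h, the
   Gaussian tail bound at the root, is a multiple of p ^ y. *)
pose f t := Phi (lrt (- t)) - binom_lt n y (- t).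
pose h t : R := (- t) ^+ y * (1 - - t) ^+ (n - y) / Z.
suff : 0 <= f (- p) by rewrite /f opprK.
apply: (@single_sign_change_ge0 R f (fun t => - df (- t)) h (- x) 0 x0').
- move=> t /andP[xt t0]; have nt : 0 < - t < 1.
    by rewrite oppr_gt0 t0 ltrNl (lt_le_trans _ xt) // ltrN2.
  by apply: (continuous_comp (g := fun t => Phi (lrt t) - binom_lt n y t));
    [exact: oppr_continuous|exact: left_cont].
- move=> t /andP[xt t0]; have nt : 0 < - t < x by rewrite oppr_gt0 t0 ltrNl.
  have D : is_derive t 1 (fun t : R => - t) (- 1) by derive_step.
  by have := is_derive_compf (g := fun t => - t) (is_derive_left nt) D; rewrite mulrN1.
- move=> s t xs st t0; rewrite oppr_lt0 oppr_le0 => /ltW.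
  have xt : - x < t by exact: lt_le_trans st.
  have sx : - s < x by rewrite ltrNl.
  have tx : - t < x by rewrite ltrNl.
  have s0 : s < 0 by exact: le_lt_trans t0.
  apply: df_ge0.
  + by rewrite oppr_gt0 t0 (lt_trans tx).
  + by rewrite oppr_gt0 s0 (lt_trans sx).
  + by apply: kl_ratio_gt0; rewrite ?lt_eqF // oppr_gt0 s0 (lt_trans sx).
  + by apply: kl_ratio_left => //; rewrite ?oppr_gt0 // lerN2.
- apply: (is_derive_continuous (a := (- 0) ^+ y * (1 - - 0) ^+ (n - y) * 0 + Z^-1 *
    ((- 0) ^+ y * ((n - y)%:R * (1 - - 0) ^+ (n - y).-1 * (0 - - 1)) +
     (1 - - 0) ^+ (n - y) * (y%:R * (- 0) ^+ y.-1 * - 1)))).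
  by rewrite /h; derive_step.
- by rewrite /h oppr0 expr0n gtn_eqF // !mul0r.
- move=> t /andP[xt t0]; have nt : 0 < - t < 1.
    by rewrite oppr_gt0 t0 ltrNl (lt_trans _ xt) // ltrN2.
  rewrite /h /f -expR_lrt //.
  have l0 : 0 <= lrt (- t) by exact: sqrtr_ge0.
  have b1 : binom_lt n y (- t) <= 1.
    by apply: binom_lt_le1; [exact: leqW (ltnW yn)|case/andP: nt => ? ?; rewrite !ltW].
  have := one_minus_Phi_le l0; lra.
- case: start => [?|H]; [by left; rewrite /f opprK|right=> t /andP[xt t0]].
  by rewrite oppr_le0 H // oppr_gt0 t0 ltrNl.
- by rewrite lerN2 px oppr_lt0.
Qed.

Let right_ge0 : (0 <= Phi (lrt x) - binom_lt n y x \/ (forall p, x < p < 1 -> df p <= 0)) ->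
  forall p, x <= p < 1 -> 0 <= Phi (- lrt p) - binom_lt n y p.
Proof.
move=> start.
have lx : lrt x = 0 by rewrite /lrt klxx mulr0 sqrtr0.
apply: (@single_sign_change_ge0 R (fun p => Phi (- lrt p) - binom_lt n y p) df (binom_lt n y) x 1 x1).
- by move=> t /andP[xt t1]; apply: right_cont; rewrite t1 (lt_le_trans x0).
- exact: is_derive_right.
- move=> s t xs st t1 /ltW; have xt : x < t by exact: lt_le_trans st.
  have t01 : 0 < t < 1 by rewrite t1 (lt_trans x0).
  have s01 : 0 < s < 1 by rewrite (lt_trans x0) // (le_lt_trans st).
  by apply: df_le0 => //; [apply: kl_ratio_gt0 => //; rewrite gt_eqF|apply: kl_ratio_right].
- exact: binom_cont.
- rewrite /binom_lt big_nat big1 // => i /andP[_ iy].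
  by rewrite subrr expr0n subn_eq0 leqNgt (ltn_trans iy yn) !mulr0.
- by move=> t _; rewrite lerDr Phi_ge0.
by move: start; rewrite lx oppr0.
Qed.

(** Compare the derivatives in p of the two sides. Their difference is a
    positive factor times y C(n, y) - K / S p, where S is increasing in the
    ratio [kl_ratio] and hence decreasing in p. According to the sign of
    this bracket at p = x, the difference of the two sides is monotone on
    one side of x, which settles that side and the value at x; the other
    side then starts from a nonnegative value and its derivative changes
    sign at most once. *)
Lemma binom_lt_le_lrt p : (0 < p <= x -> binom_lt n y p <= Phi (lrt p)) /\
  (x <= p < 1 -> binom_lt n y p <= Phi (- lrt p)).
Proof.
have lx : lrt x = 0 by rewrite /lrt klxx mulr0 sqrtr0.
pose N0 : R := (1 - x) / (2 * x).
have N00 : 0 < N0 by apply: divr_gt0; [rewrite subr_gt0|apply: mulr_gt0].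
have n2 : 0 < 2 * n%:R :> R by rewrite mulr_gt0.
suff [H|H] : (forall p, 0 < p < x -> 0 <= df p) \/ (forall p, x < p < 1 -> df p <= 0).
- have L := left_ge0 (or_intror H).
  have Lx : 0 <= Phi (lrt x) - binom_lt n y x by apply: L; rewrite x0 lexx.
  have Rt := right_ge0 (or_introl Lx).
  by split=> h; rewrite -subr_ge0; [exact: L|exact: Rt].
- have Rt := right_ge0 (or_intror H).
  have Rx : 0 <= Phi (lrt x) - binom_lt n y x.
    by have := Rt x; rewrite lx oppr0 lexx => /(_ x1).
  have L := left_ge0 (or_introl Rx).
  by split=> h; rewrite -subr_ge0; [exact: L|exact: Rt].
have K0 : 0 < K by rewrite divr_gt0 // mulr_gt0 // normal_peak1_gt0.
pose S0 := Num.sqrt (2 * n%:R * N0).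
have S00 : 0 < S0 by rewrite /S0 sqrtr_gt0 mulr_gt0.
have [h|/ltW h] := leP (K / S0) (y%:R * 'C(n, y)%:R); [left|right].
- move=> t /andP[t0 tx]; have t1 : t < 1 by exact: lt_trans x1.
  have tt : 0 < t < 1 by rewrite t0.
  rewrite /df mulr_ge0 ?mulr_ge0 ?exprn_ge0 ?subr_ge0 ?(ltW t0) ?(ltW t1) //.
  apply: le_trans h; apply: ler_wpM2l; first exact: ltW.
  have SS : S0 <= S t by rewrite /S0 /S ler_wsqrtr // ler_pM2l // kl_ratio_left_ge.
  have St : 0 < S t by exact: lt_le_trans S00 SS.
  by rewrite lef_pV2 ?posrE.
- move=> t /andP[xt t1]; have t0 : 0 < t by exact: lt_trans xt.
  have tt : 0 < t < 1 by rewrite t0.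
  rewrite /df mulr_ge0_le0 ?mulr_ge0 ?exprn_ge0 ?subr_ge0 ?(ltW t0) ?(ltW t1) // subr_le0.
  apply: le_trans h _; apply: ler_wpM2l; first exact: ltW.
  have SS : S t <= S0 by rewrite /S0 /S ler_wsqrtr // ler_pM2l // kl_ratio_right_le.
  have St : 0 < S t.
    rewrite /S sqrtr_gt0; apply: mulr_gt0 => //.
    by apply: kl_ratio_gt0 => //; rewrite gt_eqF.
  by rewrite lef_pV2 ?posrE.
Qed.

End ZubkovSerov.

(** * From the likelihood ratio to the standardized variable *)

Section Endpoint.
Variable R : realType.
Implicit Types (p s z : R) (n y k : nat).

(** The divergence n kl (y / n) p in terms of the expected counts a, b and
    of the deviation D = y - a, the variables in which the bounds on the
    logarithm are stated. *)
Definition half_lrt (a b D : R) : R := (a + D) * ln (1 + D / a) + (b - D) * ln (1 - D / b).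

Lemma half_lrt_kl n y p : (0 < y)%N -> (y < n)%N -> 0 < p < 1 ->
  n%:R * kl (y%:R / n%:R) p =
  half_lrt (n%:R * p) (n%:R * (1 - p)) (y%:R - n%:R * p).
Proof.
move=> y0 yn /andP[p0 p1]; have q0 : 0 < 1 - p by rewrite subr_gt0.
have n0 : 0 < n%:R :> R by rewrite ltr0n (leq_trans _ yn).
have yR : 0 < y%:R :> R by rewrite ltr0n.
have nyR : 0 < n%:R - y%:R :> R by rewrite subr_gt0 ltr_nat.
have x0 : 0 < y%:R / n%:R :> R by rewrite divr_gt0.
have x1 : 0 < 1 - y%:R / n%:R :> R.
  by have -> : 1 - y%:R / n%:R = (n%:R - y%:R) / n%:R :> R; [field; rewrite gt_eqF|rewrite divr_gt0].
rewrite /kl /half_lrt -!ln_div ?posrE //.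
have -> : 1 + (y%:R - n%:R * p) / (n%:R * p) = y%:R / n%:R / p :> R.
  by field; rewrite !gt_eqF.
have -> : 1 - (y%:R - n%:R * p) / (n%:R * (1 - p)) = (1 - y%:R / n%:R) / (1 - p) :> R.
  by field; rewrite !gt_eqF.
move: (ln _) (ln _) => l1 l2.
by field; rewrite gt_eqF.
Qed.

Lemma right_endpoint a b D : 0 < a -> 0 < b -> 0 <= D <= b ->
  let s := Num.sqrt (a^-1 + b^-1) in s <= 1054 / 1000 ->
  Phi (Num.sqrt (2 * half_lrt a b D)) - Phi (D * s - s) <= 4748 / 10000 * s.
Proof.
move=> a0 b0 Db s s1; have /andP[D0 Db'] := Db.
have a0' : 0 < a^-1 by rewrite invr_gt0.
have b0' : 0 < b^-1 by rewrite invr_gt0.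
have s0 : 0 < s by rewrite sqrtr_gt0 addr_gt0.
have s2 : s ^+ 2 = a^-1 + b^-1 by rewrite sqr_sqrtr // ltW // addr_gt0.
have v0 : 0 <= D * s by rewrite mulr_ge0 // ltW.
apply: right_tail_ineq => //; first by rewrite s0.
have X0 : 0 <= D * s ^+ 2 by rewrite mulr_ge0 // sqr_ge0.
have -> : D * s + 42 / 100 * (D * s) ^+ 2 * s = D * s * (1 + 42 / 100 * (D * s ^+ 2)) by ring.
have f0 : 0 <= 1 + 42 / 100 * (D * s ^+ 2) by lra.
rewrite -[leRHS]ger0_norm; last by rewrite mulr_ge0.
rewrite -sqrtr_sqr; apply: ler_wsqrtr.
apply: le_trans (divergence_le a0 b0 Db) _.
set u := D / b.
have u0 : 0 <= u <= 1 by rewrite /u ler_pdivrMr // mul1r Db' andbT divr_ge0 // ltW.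
have uX : u <= D * s ^+ 2 by rewrite s2 mulrDr lerDr mulr_ge0 // ltW.
(* With u = D / b and X = v s >= u, the factor 1 + u / 3 + 2 u ^ 2 / 3 of
   [divergence_le] is at most (1 + 0.42 u) ^ 2 on [0, 1]. *)
have k1 : 1 <= (1 + 42 / 100 * (D * s ^+ 2)) ^+ 2 by nra.
have k2 : 1 + u / 3 + 2 * u ^+ 2 / 3 <= (1 + 42 / 100 * u) ^+ 2 by nra.
have k3 : (1 + 42 / 100 * u) ^+ 2 <= (1 + 42 / 100 * (D * s ^+ 2)) ^+ 2 by nra.
move: (D * s ^+ 2) k1 k3 => X k1 k3.
have -> : (D * s * (1 + 42 / 100 * X)) ^+ 2 =
    D ^+ 2 / a * (1 + 42 / 100 * X) ^+ 2 + D ^+ 2 / b * (1 + 42 / 100 * X) ^+ 2.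
  by rewrite exprMn exprMn s2; ring.
apply: lerD.
  by rewrite -[leLHS]mulr1; apply: ler_wpM2l => //; rewrite mulr_ge0 ?sqr_ge0 // ltW.
by apply: ler_wpM2l; [rewrite mulr_ge0 ?sqr_ge0 // ltW|exact: le_trans k3].
Qed.

Lemma left_endpoint a b D : 0 < a -> 0 < b -> 0 <= D < a ->
  let s := Num.sqrt (a^-1 + b^-1) in 0 < half_lrt a b (- D) ->
  Phi (D * s + s) - Phi (Num.sqrt (2 * half_lrt a b (- D))) <= 4748 / 10000 * s.
Proof.
move=> a0 b0 Da s L0; have /andP[D0 Da'] := Da.
have a0' : 0 < a^-1 by rewrite invr_gt0.
have b0' : 0 < b^-1 by rewrite invr_gt0.
have s0 : 0 < s by rewrite sqrtr_gt0 addr_gt0.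
have s2 : s ^+ 2 = a^-1 + b^-1 by rewrite sqr_sqrtr // ltW // addr_gt0.
have v0 : 0 <= D * s by rewrite mulr_ge0 // ltW.
have L2 : 0 < 2 * half_lrt a b (- D) by rewrite mulr_gt0.
apply: left_tail_ineq => //; first by rewrite sqrtr_gt0.
rewrite sqr_sqrtr; last exact: ltW.
have -> : D * s * s = D * s ^+ 2 by ring.
have := divergence_ge a0 b0 Da.
have -> : (a - D) * ln (1 - D / a) + (b + D) * ln (1 + D / b) = half_lrt a b (- D).
  by rewrite /half_lrt !mulNr !opprK.
rewrite exprMn s2 => h.
have k0 : 0 <= 1 + D * (a^-1 + b^-1) / 3.
  have : 0 <= D * (a^-1 + b^-1) by rewrite mulr_ge0 // ltW // addr_gt0.
  lra.
apply: le_trans (ler_wpM2r k0 h).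
have d0 : 0 <= D / b by rewrite mulr_ge0 // ltW.
have d1 : 0 <= D / a by rewrite mulr_ge0 // ltW.
have -> : D ^+ 2 / (b * (1 + D / (3 * b))) = D ^+ 2 / b / (1 + D / b / 3).
  by field; rewrite !gt_eqF //; lra.
have -> : D * (a^-1 + b^-1) / 3 = D / a / 3 + D / b / 3 by ring.
rewrite mulrDr mulrDl; apply: lerD.
  by rewrite ler_peMr ?mulr_ge0 ?sqr_ge0 ?(ltW a0') //; lra.
rewrite [leRHS]mulrAC ler_pdivlMr; last lra.
apply: ler_wpM2l; last lra.
by rewrite mulr_ge0 ?sqr_ge0 // ltW.
Qed.

End Endpoint.

(** * The normal approximation of the binomial law *)

Lemma rate_ge0 (R : realType) (s : R) : 0 < s -> 0 <= 4748 / 10000 * s.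
Proof.
by move=> s0; apply: mulr_ge0; [apply: divr_ge0; exact: ler0n|exact: ltW].
Qed.

Section BinomialNormal.
Variable R : realType.
Implicit Types (p z : R) (n y k : nat).

Definition inv_stddev n p : R := (Num.sqrt (n%:R * p * (1 - p)))^-1.

Lemma inv_stddevE n p : (0 < n)%N -> 0 < p < 1 ->
  Num.sqrt ((n%:R * p)^-1 + (n%:R * (1 - p))^-1) = inv_stddev n p.
Proof.
move=> n0 /andP[p0 p1]; have q0 : 0 < 1 - p by rewrite subr_gt0.
have nR : 0 < n%:R :> R by rewrite ltr0n.
rewrite /inv_stddev -sqrtrV ?mulr_ge0 ?ltW //; congr Num.sqrt.
by field; rewrite !gt_eqF.
Qed.

Lemma inv_stddev_gt0 n p : (0 < n)%N -> 0 < p < 1 -> 0 < inv_stddev n p.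
Proof.
move=> n0 /andP[p0 p1].
by rewrite invr_gt0 sqrtr_gt0 !mulr_gt0 ?ltr0n // subr_gt0.
Qed.

Lemma inv_stddev_sqr n p : (0 < n)%N -> 0 < p < 1 -> n%:R * p * (1 - p) * inv_stddev n p ^+ 2 = 1.
Proof.
move=> n0 /andP[p0 p1].
have h : 0 < n%:R * p * (1 - p) by rewrite !mulr_gt0 ?ltr0n // subr_gt0.
by rewrite /inv_stddev exprVn sqr_sqrtr ?ltW // divff // gt_eqF.
Qed.

Lemma inv_stddevC n p : inv_stddev n (1 - p) = inv_stddev n p.
Proof. by rewrite /inv_stddev subKr mulrAC. Qed.

(** The case y = n, where P (S < n) = 1 - p ^ n and the root of the
    likelihood ratio is sqrt (- 2 n ln p). *)
Lemma binom_lt_last n p : (0 < n)%N -> 0 < p < 1 ->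
  binom_lt n n p <= Phi (Num.sqrt (2 * half_lrt (n%:R * p) (n%:R * (1 - p)) (n%:R * (1 - p)))).
Proof.
move=> n0 /andP[p0 p1]; have q0 : 0 < 1 - p by rewrite subr_gt0.
have nR : 0 < n%:R :> R by rewrite ltr0n.
have -> : half_lrt (n%:R * p) (n%:R * (1 - p)) (n%:R * (1 - p)) = - (n%:R * ln p).
  rewrite /half_lrt subrr mul0r addr0 -mulrDr addrC subrK mulr1 -mulrN -lnV ?posrE //.
  by congr (_ * ln _); field; rewrite !gt_eqF.
set r := Num.sqrt _.
have lp : ln p <= 0 by rewrite ln_le0 // ltW.
have r2 : expR (- (r ^+ 2 / 2)) = p ^+ n.
  rewrite sqr_sqrtr; last by rewrite mulr_ge0 // oppr_ge0 mulr_ge0_le0 // ltW.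
  rewrite -[X in _ = X ^+ n](@lnK _ p) ?posrE // -expRM_natl; congr expR; by field.
have := one_minus_Phi_le (sqrtr_ge0 _ : 0 <= r); rewrite r2.
have := binom_lt_all n p; rewrite /binom_lt big_nat_recr //= binn subnn expr0 mulr1 mul1r.
lra.
Qed.

Lemma binom_lt0 n p : binom_lt n 0 p = 0.
Proof. by rewrite /binom_lt big_geq. Qed.

Lemma binom_lt_le_Phi n y p : (0 < n)%N -> 0 < p < 1 -> (y <= n)%N -> inv_stddev n p <= 1054 / 1000 ->
  binom_lt n y p <= Phi ((y%:R - 1 - n%:R * p) * inv_stddev n p) + 4748 / 10000 * inv_stddev n p.
Proof.
move=> n0 p01 yn s1; have s0 := inv_stddev_gt0 n0 p01; have /andP[p0 p1] := p01.
have q0 : 0 < 1 - p by rewrite subr_gt0.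
have nR : 0 < n%:R :> R by rewrite ltr0n.
have a0 : 0 < n%:R * p by rewrite mulr_gt0.
have b0 : 0 < n%:R * (1 - p) by rewrite mulr_gt0.
case: (posnP y) => [->|y0].
  by rewrite binom_lt0; apply: addr_ge0; [exact: Phi_ge0|exact: rate_ge0].
have -> : (y%:R - 1 - n%:R * p) * inv_stddev n p = (y%:R - n%:R * p) * inv_stddev n p - inv_stddev n p by ring.
have yR : 0 < y%:R :> R by rewrite ltr0n.
have yb : y%:R - n%:R * p <= n%:R * (1 - p).
  by rewrite mulrBr mulr1 lerD2r ler_nat.
have [npy|ynp] := leP (n%:R * p) y%:R.
  have D0 : 0 <= y%:R - n%:R * p <= n%:R * (1 - p) by rewrite subr_ge0 npy.
  have := right_endpoint a0 b0 D0; rewrite (inv_stddevE n0 p01) => /(_ s1).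
  have h : binom_lt n y p <= Phi (Num.sqrt (2 * half_lrt (n%:R * p) (n%:R * (1 - p))
      (y%:R - n%:R * p))).
    move: yn; rewrite leq_eqVlt => /predU1P[->|yn].
      have -> : n%:R - n%:R * p = n%:R * (1 - p) by ring.
      exact: binom_lt_last.
    rewrite -half_lrt_kl // mulrA; apply: (binom_lt_le_lrt y0 yn erefl p).1.
    by rewrite p0 ler_pdivlMr // mulrC.
  by move: h; clear; lra.
have yn' : (y < n)%N.
  by rewrite -(ltr_nat R); apply: (lt_trans ynp); rewrite gtr_pMr.
have D0 : 0 <= n%:R * p - y%:R < n%:R * p by rewrite subr_ge0 (ltW ynp) gtrBl.
have := left_endpoint a0 b0 D0; rewrite (inv_stddevE n0 p01) opprB -half_lrt_kl //.
have x01 : 0 < (y%:R / n%:R : R) < 1.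
  by rewrite ltr_pdivrMr // mul1r ltr_nat yn' andbT divr_gt0.
have xp : y%:R / n%:R < p :> R by rewrite ltr_pdivrMr // mulrC.
have k0 : 0 < kl (y%:R / n%:R) p by rewrite kl_gt0 // gt_eqF.
rewrite (mulr_gt0 nR k0) => /(_ isT) h2.
have := (binom_lt_le_lrt y0 yn' erefl p).2; rewrite (ltW xp) p1 => /(_ isT).
rewrite /lrt -mulrA PhiN => h3.
have -> : (y%:R - n%:R * p) * inv_stddev n p - inv_stddev n p = - ((n%:R * p - y%:R) * inv_stddev n p + inv_stddev n p) by ring.
rewrite PhiN; lra.
Qed.

(** The upper bound applied to n - S, a binomial variable with parameter 1 -
    p. For y = 0 the probability vanishes and the claim is a bound for the
    normal tail beyond n p s >= 1 / s. *)
Lemma Phi_le_binom_lt n y p : (0 < n)%N -> 0 < p < 1 -> (y <= n.+1)%N -> inv_stddev n p <= 1054 / 1000 ->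
  Phi ((y%:R - n%:R * p) * inv_stddev n p) - 4748 / 10000 * inv_stddev n p <= binom_lt n y p.
Proof.
move=> n0 p01 yn s1; have s0 := inv_stddev_gt0 n0 p01; have /andP[p0 p1] := p01.
have q0 : 0 < 1 - p by rewrite subr_gt0.
have nR : 0 < n%:R :> R by rewrite ltr0n.
case: (posnP y) => [->|y0].
  rewrite binom_lt0 subr_le0 sub0r mulNr PhiN.
  have h : (inv_stddev n p)^-1 <= n%:R * p * inv_stddev n p.
    have E := inv_stddev_sqr n0 p01.
    have -> : (inv_stddev n p)^-1 = n%:R * p * (1 - p) * inv_stddev n p.
      by rewrite -[LHS]mul1r -[X in X * _ = _]E; field; rewrite gt_eqF.
    apply: ler_wpM2r; first exact: ltW.
    by rewrite ler_piMr // ?mulr_ge0 ?(ltW p0) // gerBl ltW.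
  have i0 : 0 < (inv_stddev n p)^-1 by rewrite invr_gt0.
  apply: (@le_trans _ _ (1 - Phi (inv_stddev n p)^-1)); first by rewrite lerB // Phi_mono.
  apply: le_trans (mills i0) _; rewrite invrK; apply: ler_wpM2r; first exact: ltW.
  apply: le_trans (phi_le_peak _) _; have := normal_peak1_le R; lra.
have q01 : 0 < 1 - p < 1 by rewrite q0 gtrBl.
have y'n : (n.+1 - y <= n)%N by lia.
have := binom_lt_le_Phi n0 q01 y'n; rewrite inv_stddevC => /(_ s1).
rewrite (binom_lt_sym p yn) natrB //.
have -> : (n.+1%:R - y%:R - 1 - n%:R * (1 - p)) * inv_stddev n p = - ((y%:R - n%:R * p) * inv_stddev n p).
  by rewrite -natr1; ring.
by rewrite PhiN; lra.
Qed.

Lemma binom_lt_le_Phi_all n y p : (0 < n)%N -> 0 < p < 1 -> (y <= n.+1)%N -> inv_stddev n p <= 1054 / 1000 ->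
  binom_lt n y p <= Phi ((y%:R - 1 - n%:R * p) * inv_stddev n p) + 4748 / 10000 * inv_stddev n p.
Proof.
move=> n0 p01 yn s1; have /andP[p0 p1] := p01.
have q01 : 0 < 1 - p < 1 by rewrite subr_gt0 p1 gtrBl.
have y'n : (n.+1 - y <= n.+1)%N by lia.
have := Phi_le_binom_lt n0 q01 y'n; rewrite inv_stddevC => /(_ s1).
rewrite (binom_lt_sym p yn) natrB //.
have -> : (n.+1%:R - y%:R - n%:R * (1 - p)) * inv_stddev n p = - ((y%:R - 1 - n%:R * p) * inv_stddev n p).
  by rewrite -natr1; ring.
by rewrite PhiN; lra.
Qed.

Definition binom_pmf n p k : R := 'C(n, k)%:R * (p ^+ k * (1 - p) ^+ (n - k)).

Lemma down_closed_threshold n (Q : pred nat) : (forall i j, (i <= j)%N -> Q j -> Q i) ->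
  exists2 k, (k <= n.+1)%N & forall i, (i < n.+1)%N -> Q i = (i < k)%N.
Proof.
move=> dQ; elim: n.+1 => [|m [k km IH]]; first by exists 0%N.
case Qm : (Q m).
  exists m.+1 => // i im; rewrite im; apply: dQ Qm; by rewrite -ltnS.
exists k; first exact: leqW.
move=> i; rewrite ltnS leq_eqVlt => /predU1P[->|/IH //].
by rewrite Qm ltnNge km.
Qed.

(** A down-closed condition on the count is of the form S < k, and z lies
    between the standardized values of k - 1 and k. Covering strict and weak
    inequalities together avoids separate treatment of atoms. *)
Lemma binom_down_closed n p (Q : pred nat) z : (0 < n)%N -> 0 < p < 1 -> inv_stddev n p <= 1054 / 1000 ->
  (forall i j, (i <= j)%N -> Q j -> Q i) ->
  (forall i, Q i -> (i%:R - n%:R * p) * inv_stddev n p <= z) ->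
  (forall i, ~~ Q i -> z <= (i%:R - n%:R * p) * inv_stddev n p) ->
  `|\sum_(0 <= i < n.+1 | Q i) binom_pmf n p i - Phi z| <= 4748 / 10000 * inv_stddev n p.
Proof.
move=> n0 p01 s1 dQ Qle Qge; have s0 := inv_stddev_gt0 n0 p01.
have cs := rate_ge0 s0.
have [k kn Qk] := down_closed_threshold n dQ.
have -> : \sum_(0 <= i < n.+1 | Q i) binom_pmf n p i = binom_lt n k p.
  rewrite big_mkcond (eq_big_nat _ _ (F2 := fun i =>
    if (i < k)%N then binom_pmf n p i else 0)); last first.
    by move=> i /andP[_ ilt]; rewrite Qk.
  rewrite (big_cat_nat (n := k)) //= [X in _ + X]big1_seq ?addr0; last first.
    by move=> i /=; rewrite mem_index_iota => /andP[ki _]; rewrite ltnNge ki.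
  by rewrite /binom_lt; apply: eq_big_nat => i /andP[_ ->].
rewrite ler_distl; apply/andP; split.
  have [kn1|nk] := ltnP k n.+1.
    have := Phi_le_binom_lt n0 p01 kn s1; apply: le_trans; rewrite lerD2r.
    by apply/Phi_mono/Qge; rewrite Qk // ltnn.
  have -> : k = n.+1 by apply/eqP; rewrite eqn_leq kn.
  by rewrite binom_lt_all; have := Phi_le1 z; move: cs; clear; lra.
case: k kn Qk => [|k] kn Qk.
  by rewrite binom_lt0; apply: addr_ge0 => //; exact: Phi_ge0.
have := binom_lt_le_Phi_all n0 p01 kn s1; move=> /le_trans; apply; rewrite lerD2r.
have -> : k.+1%:R - 1 - n%:R * p = k%:R - n%:R * p by rewrite -natr1; ring.
by apply/Phi_mono/Qle; rewrite Qk.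
Qed.

(** The interval [- z, z] is the difference of W <= z and W < - z. *)
Lemma binom_interval n p z : (0 < n)%N -> 0 < p < 1 -> inv_stddev n p <= 1054 / 1000 -> 0 <= z ->
  `|\sum_(0 <= i < n.+1 | `|(i%:R - n%:R * p) * inv_stddev n p| <= z) binom_pmf n p i
    - (Phi z - Phi (- z))| <= 2 * (4748 / 10000 * inv_stddev n p).
Proof.
move=> n0 p01 s1 z0; have s0 := inv_stddev_gt0 n0 p01.
pose W i : R := (i%:R - n%:R * p) * inv_stddev n p.
have Wmono i j : (i <= j)%N -> W i <= W j.
  by move=> ij; rewrite ler_pM2r // lerD2r ler_nat.
have U := @binom_down_closed n p (fun i => W i <= z) z n0 p01 s1
  (fun i j ij => le_trans (Wmono i j ij)) (fun i => id).
have {}U := U (fun i h => ltW (eqbLR (esym (ltNge _ _)) h)).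
have L := @binom_down_closed n p (fun i => W i < - z) (- z) n0 p01 s1
  (fun i j ij => le_lt_trans (Wmono i j ij)) (fun i => @ltW _ _ _ _).
have {}L := L (fun i h => eqbLR (esym (leNgt _ _)) h).
have E : \sum_(0 <= i < n.+1 | W i <= z) binom_pmf n p i =
   \sum_(0 <= i < n.+1 | `|W i| <= z) binom_pmf n p i +
   \sum_(0 <= i < n.+1 | W i < - z) binom_pmf n p i.
  rewrite [LHS](bigID (fun i => - z <= W i)) /=; congr (_ + _); apply: eq_bigl => i.
    by rewrite ler_norml andbC.
  by rewrite -ltNge andb_idl // => h; apply/ltW/(lt_le_trans h); lra.
move: U L; rewrite E; move: (\sum_(0 <= i < n.+1 | `|W i| <= z) _) => A.
move: (\sum_(0 <= i < n.+1 | W i < - z) _) => B.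
move: (4748 / 10000 * _) => e.
rewrite !ler_norml => /andP[U1 U2] /andP[L1 L2]; apply/andP; split; lra.
Qed.

End BinomialNormal.

(** * The law of a cell count *)

Lemma measure_finType_bigcup d (T : measurableType d) (R : realType)
    (mu : {measure set T -> \bar R}) (I : finType) (D : pred I) (F : I -> set T) :
  trivIset setT F -> (forall i, measurable (F i)) ->
  mu (\bigcup_(i in [set i | D i]) F i) = (\sum_(i | D i) mu (F i))%E.
Proof.
move=> tF mF.
have -> : [set i | D i] = [set` [seq i <- index_enum I | D i]].
  by apply/seteqP; split=> i /=; rewrite mem_filter mem_index_enum ?andbT.
rewrite measure_fin_bigcup //; last exact: sub_trivIset tF.
by rewrite -fsbig_seq ?filter_uniq ?index_enum_uniq // big_filter.
Qed.

Section CountLaw.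
Variables (d : measure_display) (T : measurableType d) (R : realType)
  (P : probability T R) (n : nat) (p : 'I_2 -> R) (X : 'I_n -> {RV P >-> 'I_2}).
Hypothesis p1 : p ord0 + p ord_max = 1.
Hypothesis trials : classification_trials p X.

Let cells (w : T) : {set 'I_n} := [set i | X i w == ord0]%SET.
Let pattern (J : {set 'I_n}) : set T := [set w | cells w = J].
Let side (J : {set 'I_n}) (i : 'I_n) : set 'I_2 := [set if i \in J then ord0 else ord_max].

Let ord2 (j : 'I_2) : (j != ord0) = (j == ord_max).
Proof. by case: j => [[|[|?]] ?]. Qed.

Let patternE J : pattern J = \bigcap_(i in [set` [set: 'I_n]%SET]) (X i @^-1` side J i).
Proof.
apply/seteqP; split=> w /=.
  move=> <- i _; rewrite /side /cells /= finset.inE.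
  by case: eqVneq => // /[!ord2] /eqP.
move=> H; apply/setP => i; rewrite finset.inE.
have := H i; rewrite /side /= finset.in_setT => /(_ isT) ->.
by case: (i \in J).
Qed.

Let P_pattern J : P (pattern J) = (p ord0 ^+ #|J| * (1 - p ord0) ^+ (n - #|J|))%:E.
Proof.
have [ind marg] := trials.
have -> : 1 - p ord0 = p ord_max by rewrite -p1 addrAC subrr add0r.
rewrite patternE ind // (eq_bigr (fun i => (p (if i \in J then ord0 else ord_max))%:E)); last first.
  by move=> i _; rewrite /side marg.
rewrite prodEFin; congr EFin.
rewrite (eq_bigl predT); last by move=> i; rewrite finset.in_setT.
rewrite (bigID (fun i => i \in J)) /=; congr (_ * _).
  by rewrite (eq_bigr (fun=> p ord0)) ?prodr_const // => i ->.
rewrite (eq_bigr (fun=> p ord_max)) ?prodr_const; last by move=> i /negbTE ->.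
congr (_ ^+ _); have Jn : (#|J| + #|[predC J]|)%N = n by rewrite cardC card_ord.
have <- : #|[predC J]| = (n - #|J|)%N by move: Jn; lia.
exact: eq_card.
Qed.

(** The trials that fall into the first cell form a random set; by
    independence each set of k trials has probability p ^ k (1 - p) ^ (n -
    k), and there are C(n, k) of them. *)
Lemma cell_count_law (Q : pred nat) :
  P [set w | Q (cell_count X ord0 w)] =
  (\sum_(0 <= k < n.+1 | Q k) binom_pmf n (p ord0) k)%:E.
Proof.
have -> : [set w | Q (cell_count X ord0 w)] = \bigcup_(J in [set J : {set 'I_n} | Q #|J|]) pattern J.
  apply/seteqP; split=> w /=; first by move=> Qw; exists (cells w).
  by move=> [J /= QJ wJ]; move: QJ; rewrite -[J]wJ.
rewrite (measure_finType_bigcup P (fun J : {set 'I_n} => Q #|J|)); first last.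
- move=> J; rewrite patternE; apply: fin_bigcap_measurable => //.
  by move=> i _; exact: measurable_funPTI.
- by move=> J K _ _ [w [/= <- <-]].
rewrite (eq_bigr _ (fun J _ => P_pattern J)) sumEFin; congr EFin.
rewrite (partition_big (fun J : {set 'I_n} => inord #|J| : 'I_n.+1) (fun k => Q k)) /=; last first.
  by move=> J QJ; rewrite inordK // ltnS; have := max_card J; rewrite card_ord.
rewrite big_mkord; apply: eq_bigr => k Qk.
rewrite (eq_bigl (fun J : {set 'I_n} => #|J| == k)); last first.
  move=> J; have Jn : (#|J| < n.+1)%N by rewrite ltnS; have := max_card J; rewrite card_ord.
  rewrite -val_eqE /= inordK //; apply: andb_idl => /eqP ->; exact: Qk.
rewrite (eq_bigr (fun=> p ord0 ^+ k * (1 - p ord0) ^+ (n - k))); last by move=> J /eqP ->.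
have E : 'C(n, k) = #|[set J : {set 'I_n} | #|J| == k]%SET| by rewrite card_draws card_ord.
rewrite /binom_pmf E -sum1_card natr_sum mulr_suml.
by apply: eq_big => [J|J _]; rewrite ?finset.inE ?mul1r.
Qed.

Lemma cell_count_max w : cell_count X ord_max w = (n - cell_count X ord0 w)%N.
Proof.
have Jn : (#|cells w| + #|~: cells w|)%N = n by rewrite cardsC card_ord.
have C0 : cell_count X ord0 w = #|cells w| by [].
have -> : (n - cell_count X ord0 w)%N = #|~: cells w|.
  by rewrite C0; move: #|cells w| #|~: cells w| Jn => a b; lia.
by apply: eq_card => i; rewrite !finset.inE -ord2.
Qed.

Lemma cell_count_le w : (cell_count X ord0 w <= n)%N.
Proof. by have := max_card (cells w); rewrite card_ord. Qed.

End CountLaw.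

(** * The chi-square distribution function *)

Section ChiSquare.
Variable R : realType.

Lemma normal_prob_pt (x : R) : normal_prob 0 1 [set x] = 0%E.
Proof.
have /null_content_dominatesP h := @normal_prob_dominates R 0 1.
by apply: h; [exact: measurable_set1|exact: lebesgue_measure_set1].
Qed.

Lemma normal_prob_itvcc (a b : R) : a <= b ->
  fine (normal_prob 0 1 `[a, b]) = Phi b - Phi a.
Proof.
move=> ab; pose P : probability (measurableTypeR R) R := normal_prob (0:R) 1.
have E1 : P `]-oo, b]%classic = (P `]-oo, a]%classic + P `]a, b]%classic)%E.
  rewrite -measureU //=; last first.
    apply/seteqP; split=> x //=; rewrite !in_itv /= => -[xa /andP[ax _]].
    by move: xa; rewrite leNgt ax.
  by rewrite -itv_bndbnd_setU // bnd_simp.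
have E2 : P `[a, b]%classic = (P [set a] + P `]a, b]%classic)%E.
  rewrite -measureU //=; last first.
    by apply/seteqP; split=> x //=; rewrite !in_itv /= => -[-> /andP[]]; rewrite ltxx.
  by rewrite setU1itv // bnd_simp.
have E3 : P [set a] = 0%E by exact: normal_prob_pt.
rewrite -[normal_prob 0 1 `[a, b]%classic]/(P `[a, b]%classic) E2 E3 add0e.
have fa : P `]-oo, a]%classic \is a fin_num by exact: fin_num_measure.
have fab : P `]a, b]%classic \is a fin_num by exact: fin_num_measure.
have : Phi b = Phi a + fine (P `]a, b]%classic) by rewrite -[Phi a]/(fine (P _)) -fineD // -E1.
by move=> ->; rewrite addrAC subrr add0r.
Qed.

Lemma chi_square1E (z : R) : 0 <= z ->
  fine (chi_square1 R `]-oo, z]%classic) = Phi (Num.sqrt z) - Phi (- Num.sqrt z).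
Proof.
move=> z0; have s0 : 0 <= Num.sqrt z by exact: sqrtr_ge0.
rewrite -normal_prob_itvcc ?ge0_cp //.
rewrite /chi_square1 /distribution /pushforward; congr (fine (normal_prob 0 1 _)).
apply/seteqP; split=> x /=; rewrite !in_itv /= -ler_norml -sqrtr_sqr.
  by move=> xz; rewrite ler_wsqrtr.
by rewrite ler_psqrt ?nnegrE ?sqr_ge0.
Qed.

Lemma chi_square1_lt0 (z : R) : z < 0 -> fine (chi_square1 R `]-oo, z]%classic) = 0.
Proof.
move=> z0; rewrite -[RHS]/(fine 0) -(measure0 (normal_prob (0 : R) 1 : probability (measurableTypeR R) R)).
rewrite /chi_square1 /distribution /pushforward; congr (fine (normal_prob 0 1 _)).
apply/seteqP; split=> x //=; rewrite in_itv /= => xz.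
by have := sqr_ge0 x; rewrite leNgt (le_lt_trans xz).
Qed.

End ChiSquare.

(** * The power divergence statistic against Pearson's *)

Section PowerDivergenceFunction.
Variable R : realType.
Implicit Types (x u lambda c eta : R).

Lemma second_deriv_ge0 (G dG ddG : R -> R) a b x : a <= 1 <= b -> a <= x <= b ->
  deriv_on a b G dG -> deriv_on a b dG ddG -> (forall u, a <= u <= b -> 0 <= ddG u) ->
  G 1 = 0 -> dG 1 = 0 -> 0 <= G x.
Proof.
move=> /andP[a1 b1] /andP[ax xb] DG DdG pos G1 dG1.
have [x1|/ltW x1] := leP x 1.
  rewrite -[leLHS]G1; apply: (deriv_le0_le G dG x1) => u /andP[xu u1].
    by apply: DG; rewrite (le_trans ax xu) (le_trans u1 b1).
  rewrite -[leRHS]dG1; apply: (deriv_ge0_le dG ddG u1) => v /andP[uv v1].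
    by apply: DdG; rewrite (le_trans (le_trans ax xu) uv) (le_trans v1 b1).
  by apply: pos; rewrite (le_trans (le_trans ax xu) uv) (le_trans v1 b1).
rewrite -[leLHS]G1; apply: (deriv_ge0_le G dG x1) => u /andP[u1 ux].
  by apply: DG; rewrite (le_trans a1 u1) (le_trans ux xb).
rewrite -[leLHS]dG1; apply: (deriv_ge0_le dG ddG u1) => v /andP[v1 vu].
  by apply: DdG; rewrite (le_trans a1 v1) (le_trans (le_trans vu ux) xb).
by apply: pos; rewrite (le_trans a1 v1) (le_trans (le_trans vu ux) xb).
Qed.

(** The summand of the statistic divided by the expected count, normalized
    by a multiple of x - 1 so that it has a double zero at 1. The added
    terms cancel in the sum over the cells. *)
Definition pd_fun lambda x : R :=
  if lambda == 0 then 2 * (x * ln x - (x - 1))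
  else 2 / (lambda * (lambda + 1)) * (x * (x `^ lambda - 1)) - 2 / (lambda + 1) * (x - 1).

Definition pd_deriv lambda x : R := if lambda == 0 then 2 * ln x else 2 / lambda * (x `^ lambda - 1).

Lemma is_derive_pd lambda x : -1 < lambda -> 0 < x ->
  is_derive x 1 (pd_fun lambda) (pd_deriv lambda x).
Proof.
move=> l1 x0; rewrite /pd_fun /pd_deriv; case: eqVneq => [_|l0].
  by derive_tac => //; field; rewrite gt_eqF.
have l1' : lambda + 1 != 0 by rewrite gt_eqF // -ltrBlDr sub0r.
derive_tac => //.
have E : x `^ lambda = x * x `^ (lambda - 1).
  have := @powRD R x 1 (lambda - 1); rewrite (gt_eqF x0) implybT => /(_ isT).
  by rewrite powRr1 ?ltW // => <-; congr (_ `^ _); ring.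
by rewrite E; field; rewrite l0 l1'.
Qed.

Lemma is_derive_pd_deriv lambda x : 0 < x ->
  is_derive x 1 (pd_deriv lambda) (2 * x `^ (lambda - 1)).
Proof.
move=> x0; rewrite /pd_deriv; case: eqVneq => [->|l0].
  by derive_tac => //; rewrite sub0r powR_inv1 ?ltW //; ring.
by derive_tac => //; field.
Qed.

(** The second derivative of [pd_fun] is 2 x ^ (lambda - 1). *)
Lemma pd_fun_bounds lambda eps a b x : -1 < lambda -> 0 < a -> a <= 1 <= b -> a <= x <= b ->
  (forall u, a <= u <= b -> `|u `^ (lambda - 1) - 1| <= eps) ->
  (1 - eps) * (x - 1) ^+ 2 <= pd_fun lambda x <= (1 + eps) * (x - 1) ^+ 2.
Proof.
move=> l1 a0 ab xab H.
have pd1 : pd_fun lambda 1 = 0.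
  by rewrite /pd_fun powR1 ln1; case: ifP => _; ring.
have dpd1 : pd_deriv lambda 1 = 0.
  by rewrite /pd_deriv powR1 ln1; case: ifP => _; ring.
have pos u : a <= u <= b -> 0 < u by move=> /andP[au _]; exact: lt_le_trans au.
apply/andP; split; rewrite -subr_ge0.
  apply: (@second_deriv_ge0 (fun x => pd_fun lambda x - (1 - eps) * (x - 1) ^+ 2)
    (fun x => pd_deriv lambda x - 2 * (1 - eps) * (x - 1))
    (fun x => 2 * x `^ (lambda - 1) - 2 * (1 - eps)) a b _ ab xab).
  - by move=> u /pos u0; derive_tac; [exact: is_derive_pd|ring].
  - by move=> u /pos u0; derive_tac; [exact: is_derive_pd_deriv|ring].
  - by move=> u /H; rewrite ler_norml => /andP[h _]; lra.
  - by rewrite pd1 subrr expr0n mulr0 subrr.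
  - by rewrite dpd1 subrr mulr0 subrr.
apply: (@second_deriv_ge0 (fun x => (1 + eps) * (x - 1) ^+ 2 - pd_fun lambda x)
    (fun x => 2 * (1 + eps) * (x - 1) - pd_deriv lambda x)
    (fun x => 2 * (1 + eps) - 2 * x `^ (lambda - 1)) a b _ ab xab).
- by move=> u /pos u0; derive_tac; [exact: is_derive_pd|ring].
- by move=> u /pos u0; derive_tac; [exact: is_derive_pd_deriv|ring].
- by move=> u /H; rewrite ler_norml => /andP[_ h]; lra.
- by rewrite pd1 subrr expr0n mulr0 subrr.
- by rewrite dpd1 subrr mulr0 subrr.
Qed.

Lemma powR_near1 c eta u : 0 <= eta <= 1 / 2 -> `|c| * eta <= 1 / 4 ->
  1 - eta <= u <= 1 + eta -> `|u `^ c - 1| <= 4 * (`|c| * eta).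
Proof.
move=> /andP[e0 e1] ce /andP[u1 u2].
have u0 : 0 < u by lra.
have lu : `|ln u| <= 2 * eta.
  have l1 : ln u <= u - 1 by have := @le_ln1Dx _ (u - 1); rewrite [1 + _]addrC subrK; apply; lra.
  have l2 : - ln u <= u^-1 - 1.
    rewrite -lnV ?posrE //; have := @le_ln1Dx _ (u^-1 - 1); rewrite [1 + _]addrC subrK; apply.
    have : 0 < u^-1 by rewrite invr_gt0.
    lra.
  have l3 : u^-1 <= 1 + 2 * eta.
    rewrite -[u^-1]mul1r ler_pdivrMr //; nra.
  rewrite ler_norml; apply/andP; split; lra.
have cu : `|c * ln u| <= 2 * (`|c| * eta).
  by rewrite normrM; have := ler_wpM2l (normr_ge0 c) lu; lra.
rewrite /powR gt_eqF //.
move: (`|c| * eta) (c * ln u) ce cu => y v y1; rewrite ler_norml => /andP[v1 v2].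
have g1 := expR_ge1Dx v.
have g2 := expR_ge1Dx (- v).
have v1' : 0 < 1 - v by lra.
have g3 : expR v * (1 - v) <= 1.
  rewrite -[leRHS](expRxMexpNx_1 v).
  by apply: ler_wpM2l; [exact: expR_ge0|lra].
have g4 : expR v <= 1 + 4 * y.
  have [v0|v0] := leP v 0; first by have : expR v <= 1; [rewrite expR_le1|lra].
  nra.
rewrite ler_norml; apply/andP; split; lra.
Qed.

End PowerDivergenceFunction.

(** * Kolmogorov distance and probabilities *)

Lemma kolmogorov_dist_le (R : realType) (mu nu : probability R R) (B : R) :
  (forall z : R, `|fine (mu `]-oo, z]%classic) - fine (nu `]-oo, z]%classic)| <= B) ->
  kolmogorov_dist mu nu <= B.
Proof.
move=> H; apply: ge_sup; first by eexists; exists 0.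
by move=> _ [z _ <-].
Qed.

Lemma fine_prob_itv d (T : measurableType d) (R : realType) (mu : probability T R) A :
  measurable A -> 0 <= fine (mu A) <= 1.
Proof.
move=> mA; rewrite fine_ge0 //= -lee_fin fineK ?probability_le1 //.
exact: fin_num_measure.
Qed.

Section Arith.
Variable R : realType.
Implicit Types (t s e A B : R).

Lemma tail_bound_arith t s A B : 1 - B <= 4 * t -> - (2 * (4748 / 10000 * s)) <= A - B -> s <= t ->
  0 < t -> 1 - A <= 5 * t.
Proof. lra. Qed.

Lemma rate_le s : 0 < s -> 2 * (4748 / 10000 * s) <= s.
Proof. lra. Qed.

Lemma sandwich_arith t e G K K1 K2 F1 F2 tail : 0 < t -> 0 <= e -> e <= 4 / 100 ->
  K1 <= K + 2 * ((1 - e)^-1 - 1) -> K <= K2 + 2 * (1 + e - 1) ->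
  G <= F1 + tail -> F2 <= G + tail -> tail <= 5 * t ->
  `|F2 - K2| <= t -> `|F1 - K1| <= t -> `|G - K| <= 6 * t + 4 * e.
Proof.
move=> t0 e0 e1 S1 S2 up down tl; rewrite !ler_norml => /andP[a1 a2] /andP[b1 b2].
have h : (1 - e)^-1 - 1 <= 2 * e.
  have e1' : 0 < 1 - e by lra.
  rewrite lerBlDr -[(1 - e)^-1]mul1r ler_pdivrMr //; nra.
apply/andP; split; lra.
Qed.
End Arith.

Lemma dist_unit_le1 (R : realType) (a b : R) : 0 <= a <= 1 -> 0 <= b <= 1 -> `|a - b| <= 1.
Proof.
by move=> /andP[a0 a1] /andP[b0 b1]; rewrite ler_norml; apply/andP; split; lra.
Qed.

Lemma prob_diff_le1 (R : realType) (mu nu : probability R R) (z : R) :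
  `|fine (mu `]-oo, z]%classic) - fine (nu `]-oo, z]%classic)| <= 1.
Proof.
have m : measurable (`]-oo, z]%classic : set R) by [].
exact: dist_unit_le1 (fine_prob_itv mu m) (fine_prob_itv nu m).
Qed.

Lemma one_le_rate (R : realType) (s : R) : 1054 / 1000 <= s -> 1 <= 2 * (4748 / 10000 * s).
Proof. by lra. Qed.

Lemma rate_twice (R : realType) (s : R) : 2 * (4748 / 10000 * s) = 9496 / 10000 * s.
Proof. by lra. Qed.

Lemma Phi_interval_unit (R : realType) (z : R) : 0 <= z -> 0 <= Phi z - Phi (- z) <= 1.
Proof.
move=> z0; rewrite PhiN; have h : Phi 0 <= Phi z := Phi_mono z0.
have h0 : Phi 0 = 1 / 2 :> R by have := PhiN (0 : R); rewrite oppr0; lra.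
have h1 := Phi_le1 z; lra.
Qed.

Lemma fine_prob_le_setU d (T : measurableType d) (R : realType) (P : probability T R) A B C :
  measurable A -> measurable B -> measurable C -> A `<=` B `|` C ->
  fine (P A) <= fine (P B) + fine (P C).
Proof.
move=> mA mB mC ABC.
rewrite -fineD ?fin_num_measure // fine_le ?fin_num_measure //.
  by rewrite fin_numD !fin_num_measure.
apply: (@le_trans _ _ (P (B `|` C))); last exact: measureU2.
by apply: le_measure => //; rewrite inE //; exact: measurableU.
Qed.

Section ChiScale.
Variable R : realType.
Implicit Types (a z r t : R).

Lemma mul_phi_le1 a : 0 <= a -> a * phi a <= 1.
Proof.
move=> a0; rewrite /phi mulrCA.
have h : a * expR (- (a ^+ 2 / 2)) <= 1.
  rewrite expRN ler_pdivrMr ?expR_gt0 // mul1r.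
  apply: le_trans (expR_ge1Dx _); have := sqr_ge0 (a - 1); nra.
have c0 := normal_peak1_gt0 R; have c1 := normal_peak1_le1 R.
by apply: le_trans (ler_wpM2l (ltW c0) h) _; rewrite mulr1.
Qed.

(** The chi-square distribution function is uniformly continuous in the
    logarithm of its argument, because a phi a is bounded. *)
Lemma Phi_interval_scale z r : 0 <= z -> 1 <= r ->
  Phi (Num.sqrt (z * r)) - Phi (- Num.sqrt (z * r)) <=
  Phi (Num.sqrt z) - Phi (- Num.sqrt z) + 2 * (r - 1).
Proof.
move=> z0 r1; rewrite !PhiN sqrtrM //.
have a0 : 0 <= Num.sqrt z by exact: sqrtr_ge0.
have r0 : 0 <= Num.sqrt r by exact: sqrtr_ge0.
have rr : Num.sqrt r ^+ 2 = r by rewrite sqr_sqrtr //; lra.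
have sr1 : 1 <= Num.sqrt r by rewrite -sqrtr1 ler_wsqrtr.
move: (Num.sqrt z) (Num.sqrt r) a0 r0 rr sr1 => a b a0 b0 bb b1.
have h : Phi (a * b) - Phi a <= phi a * (a * b - a).
  by apply: Phi_diff_le_phi; rewrite a0 ler_peMr.
have h2 : phi a * (a * b - a) <= b - 1.
  have -> : phi a * (a * b - a) = a * phi a * (b - 1) by ring.
  by rewrite -[leRHS]mul1r; apply: ler_wpM2r; [rewrite subr_ge0|exact: mul_phi_le1].
have h3 : b <= r by rewrite -bb expr2 ler_peMr.
lra.
Qed.

Lemma normal_tail_le t : 0 < t ->
  1 - (Phi (Num.sqrt t^-1) - Phi (- Num.sqrt t^-1)) <= 4 * t.
Proof.
move=> t0; have ti : 0 < t^-1 by rewrite invr_gt0.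
have h := one_minus_Phi_le (sqrtr_ge0 t^-1); move: h; rewrite (sqr_sqrtr (ltW ti)) PhiN.
have y0 : 0 <= t^-1 / 2 by rewrite divr_ge0 // ltW.
have := expRN_le_quad y0.
have : (1 + t^-1 / 2 + (t^-1 / 2) ^+ 2 / 2)^-1 <= 2 * t.
  rewrite -[2 * t]invrK lef_pV2 ?posrE ?invr_gt0 ?mulr_gt0 //; last first.
    have := sqr_ge0 (t^-1 / 2); lra.
  have -> : (2 * t)^-1 = t^-1 / 2 by field; rewrite gt_eqF.
  have := sqr_ge0 (t^-1 / 2); lra.
move: (expR _) (_^-1) (Phi _) => A B C; lra.
Qed.

(** In the range where the claim is not trivial, t and a ^ 2 t are below 1 /
    100; here a stands for |lambda - 1|. This is where a t ^ 2 is absorbed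
    by t (1 + a ^ 2). *)
Lemma fifth_root_balance t s a : 0 < t -> 0 < s -> s ^+ 2 = t ^+ 5 -> 0 <= a ->
  t * (100 + 100 * a ^+ 2) < 1 ->
  [/\ t <= 1 / 100, s <= t, a * t ^+ 2 <= 1 / 100 &
      6 * t + 16 * (a * t ^+ 2) <= t * (100 + 100 * a ^+ 2)].
Proof.
move=> t0 s0 st a0 h.
have ta : 0 <= t * a ^+ 2 by rewrite mulr_ge0 ?sqr_ge0 // ltW.
have t1 : t <= 1 / 100 by lra.
have a1 : a <= 1 + a ^+ 2 by have := sqr_ge0 (a - 1); nra.
have at_ : a * t <= t * (1 + a ^+ 2) by rewrite mulrC; apply: ler_wpM2l => //; exact: ltW.
have at0 : 0 <= a * t by rewrite mulr_ge0 // ltW.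
have at2 : a * t ^+ 2 <= 1 / 100 * (a * t).
  have -> : a * t ^+ 2 = t * (a * t) by ring.
  by apply: ler_wpM2r.
split=> //; last 2 first.
- lra.
- lra.
rewrite -ler_sqr ?nnegrE; [rewrite st|exact: ltW|exact: ltW].
have -> : t ^+ 5 = t ^+ 2 * t ^+ 3 by ring.
rewrite ler_piMr ?sqr_ge0 // exprn_ile1 //; [exact: ltW|lra].
Qed.

End ChiScale.

(** * The two statistics for two cells *)

Section TwoCells.
Variables (d : measure_display) (T : measurableType d) (R : realType)
  (P : probability T R) (n : nat) (p : 'I_2 -> R) (X : 'I_n -> {RV P >-> 'I_2}).
Hypothesis n0 : (0 < n)%N.
Hypothesis p01 : forall j, 0 < p j < 1.
Hypothesis p1 : p ord0 + p ord_max = 1.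
Hypothesis trials : classification_trials p X.

Let U w := cell_count X ord0 w.
Let s := inv_stddev n (p ord0).
Let W w : R := ((U w)%:R - n%:R * p ord0) * s.

Let q1 : p ord_max = 1 - p ord0. Proof. by rewrite -p1 addrAC subrr add0r. Qed.
Let pa : 0 < p ord0. Proof. by case/andP: (p01 ord0). Qed.
Let qa : 0 < 1 - p ord0. Proof. by rewrite -q1; case/andP: (p01 ord_max). Qed.
Let nR : 0 < n%:R :> R. Proof. by rewrite ltr0n. Qed.
Let s0 : 0 < s. Proof. exact: inv_stddev_gt0 n0 (p01 ord0). Qed.
Let s2 : n%:R * p ord0 * (1 - p ord0) * s ^+ 2 = 1. Proof. exact: inv_stddev_sqr n0 (p01 ord0). Qed.

Let sum2 (F : 'I_2 -> R) : \sum_(j < 2) F j = F ord0 + F ord_max.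
Proof. by rewrite big_ord_recr big_ord1 /=; congr (F _ + F _); apply/val_inj. Qed.

Let count_max w : (cell_count X ord_max w)%:R = n%:R - (U w)%:R :> R.
Proof. by rewrite cell_count_max natrB // cell_count_le. Qed.

(** The two squared deviations agree, and 1 / (n p) + 1 / (n q) = 1 / (n p
    q). *)
Lemma pearson_statE w : pearson_stat p X w = W w ^+ 2.
Proof.
rewrite /pearson_stat sum2 count_max q1 -/(U w) /W exprMn.
have -> : s ^+ 2 = (n%:R * p ord0 * (1 - p ord0))^-1.
  by rewrite -[RHS]mulr1 -[X in _ = _ * X]s2 mulKf // gt_eqF // !mulr_gt0.
by field; rewrite !gt_eqF.
Qed.

Lemma pearson_law (z : R) : 0 <= z ->
  fine (distribution P (pearson_stat p X) `]-oo, z]%classic) =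
  \sum_(0 <= i < n.+1 | `|(i%:R - n%:R * p ord0) * s| <= Num.sqrt z) binom_pmf n (p ord0) i.
Proof.
move=> z0; rewrite /distribution /pushforward.
rewrite -[RHS]/(fine (_)%:E) -(cell_count_law p1 trials
  (fun i => `|(i%:R - n%:R * p ord0) * s| <= Num.sqrt z)).
congr (fine (P _)); apply/seteqP; split=> w /=; rewrite in_itv /= pearson_statE -/(W w) -sqrtr_sqr.
  by move=> h; rewrite ler_wsqrtr.
by rewrite ler_psqrt ?nnegrE ?sqr_ge0.
Qed.

Lemma pearson_lt0 (z : R) : z < 0 ->
  fine (distribution P (pearson_stat p X) `]-oo, z]%classic) = 0.
Proof.
move=> z0; rewrite -[RHS]/(fine 0) -(measure0 P) /distribution /pushforward.
congr (fine (P _)); apply/seteqP; split=> w //=; rewrite in_itv /= pearson_statE => h.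
by have := sqr_ge0 (W w); rewrite leNgt (le_lt_trans h).
Qed.

Lemma pearson_cdf (z : R) : 0 <= z ->
  `|fine (distribution P (pearson_stat p X) `]-oo, z]%classic)
    - (Phi (Num.sqrt z) - Phi (- Num.sqrt z))| <= 2 * (4748 / 10000 * s).
Proof.
move=> z0; have [s1|/ltW s1] := leP s (1054 / 1000).
  rewrite pearson_law //; apply: binom_interval => //; exact: sqrtr_ge0.
have m : measurable (`]-oo, z]%classic : set R) by [].
apply: le_trans (one_le_rate s1); apply: dist_unit_le1; first exact: fine_prob_itv.
exact/Phi_interval_unit/sqrtr_ge0.
Qed.

Lemma pearson_kolmogorov :
  kolmogorov_dist (distribution P (pearson_stat p X)) (chi_square1 R) <= 9496 / 10000 * s.
Proof.
rewrite -rate_twice; apply: kolmogorov_dist_le => z; have [z0|z0] := leP 0 z.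
  by rewrite chi_square1E //; exact: pearson_cdf.
rewrite pearson_lt0 // chi_square1_lt0 // subrr normr0.
by apply: mulr_ge0; [exact: ler0n|exact: rate_ge0].
Qed.

Section PowerDivergence.
Variable lambda : R.
Hypothesis l1 : -1 < lambda.

Lemma power_divergence_statE w : power_divergence_stat p lambda X w =
  \sum_(j < 2) n%:R * p j * pd_fun lambda ((cell_count X j w)%:R / (n%:R * p j)).
Proof.
have l1' : lambda + 1 != 0 by rewrite gt_eqF // -ltrBlDr sub0r.
rewrite /power_divergence_stat /pd_fun; case: eqVneq => [_|l0]; rewrite !sum2 count_max q1 -/(U w);
  move: (U w)%:R => u.
  by move: (ln _) (ln _) => L1 L2; field; rewrite !gt_eqF.
by move: (_ `^ _) (_ `^ _) => L1 L2; field; rewrite l0 l1' !gt_eqF.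
Qed.

(** Both expected counts are at least n p q, so on |W| s <= t both ratios of
    observed to expected counts are within t of 1. *)
Lemma power_divergence_sandwich (t : R) w : 0 < t <= 1 / 2 -> `|lambda - 1| * t <= 1 / 4 ->
  `|W w| * s <= t ->
  (1 - 4 * (`|lambda - 1| * t)) * W w ^+ 2 <= power_divergence_stat p lambda X w
    <= (1 + 4 * (`|lambda - 1| * t)) * W w ^+ 2.
Proof.
move=> /andP[t0 t1] lt Wt.
set e := 4 * _.
have npq j : n%:R * p ord0 * (1 - p ord0) <= n%:R * p j.
  have j2 : j = ord0 \/ j = ord_max.
    by case: j => [[|[|?]] jp] //; [left|right]; exact: val_inj.
  case: j2 => ->; first by rewrite ler_piMr ?mulr_ge0 ?(ltW pa) // gerBl ltW.
  by rewrite q1 mulrAC ler_piMr ?mulr_ge0 ?(ltW qa) // -subr_ge0 ltW.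
have dev j : `|(cell_count X j w)%:R / (n%:R * p j) - 1| <= t.
  have np0 : 0 < n%:R * p j by rewrite mulr_gt0 //; case/andP: (p01 j).
  have -> : (cell_count X j w)%:R / (n%:R * p j) - 1 = ((cell_count X j w)%:R - n%:R * p j) / (n%:R * p j).
    by field; rewrite !gt_eqF //; case/andP: (p01 j).
  have -> : `|((cell_count X j w)%:R - n%:R * p j) / (n%:R * p j)| = `|(U w)%:R - n%:R * p ord0| / (n%:R * p j).
    rewrite normrM [`|_^-1|]gtr0_norm ?invr_gt0 //; congr (_ * _).
    have j2 : j = ord0 \/ j = ord_max.
      by case: j {np0} => [[|[|?]] jp] //; [left|right]; exact: val_inj.
    case: j2 => -> //; rewrite count_max q1 -normrN; congr `|_|; ring.
  rewrite ler_pdivrMr //.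
  have E : `|W w| * s = `|(U w)%:R - n%:R * p ord0| * s ^+ 2.
    by rewrite /W normrM [`|s|]gtr0_norm // -mulrA.
  have k : `|(U w)%:R - n%:R * p ord0| = `|W w| * s * (n%:R * p ord0 * (1 - p ord0)).
    by rewrite E -[LHS]mulr1 -[X in _ * X = _]s2; ring.
  rewrite k; apply: ler_pM => //; first by rewrite mulr_ge0 // ltW.
  by rewrite !mulr_ge0 // ltW.
have bnd j : (1 - e) * ((cell_count X j w)%:R / (n%:R * p j) - 1) ^+ 2 <=
    pd_fun lambda ((cell_count X j w)%:R / (n%:R * p j)) <=
    (1 + e) * ((cell_count X j w)%:R / (n%:R * p j) - 1) ^+ 2.
  apply: (@pd_fun_bounds _ lambda e (1 - t) (1 + t)); first exact: l1.
  - by rewrite subr_gt0 (le_lt_trans t1) // ltr_pdivrMr // mul1r ltr1n.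
  - by rewrite gerBl lerDl ltW.
  - by have := dev j; rewrite ler_norml => /andP[? ?]; apply/andP; split; lra.
  - by move=> u ut; apply: powR_near1 => //; rewrite ltW.
have pe : W w ^+ 2 = \sum_(j < 2) n%:R * p j * ((cell_count X j w)%:R / (n%:R * p j) - 1) ^+ 2.
  rewrite -pearson_statE /pearson_stat; apply: eq_bigr => j _.
  by field; rewrite !gt_eqF //; case/andP: (p01 j).
rewrite power_divergence_statE pe !mulr_sumr; apply/andP; split; apply: ler_sum => j _.
all: have np0 : 0 <= n%:R * p j by rewrite mulr_ge0 // ltW //; case/andP: (p01 j).
all: by rewrite mulrCA; apply: ler_wpM2l => //; case/andP: (bnd j).
Qed.

(** The event W ^ 2 > 1 / t is controlled by the normal approximation itself
    and the Gaussian tail, without a moment computation. *)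
Lemma pearson_tail t : 0 < t -> s <= t ->
  fine (P (~` (pearson_stat p X @^-1` `]-oo, t^-1]%classic))) <= 5 * t.
Proof.
move=> t0 st; have ti : 0 <= t^-1 by rewrite invr_ge0 ltW.
have m : measurable (pearson_stat p X @^-1` `]-oo, t^-1]%classic).
  exact: measurable_funPTI.
rewrite probability_setC // fineB ?fin_num_measure //=.
have := pearson_cdf ti; have := normal_tail_le t0.
rewrite -[fine (distribution _ _ _)]/(fine (P (pearson_stat p X @^-1` `]-oo, t^-1]%classic))).
by move=> h; rewrite ler_norml => /andP[h1 _]; exact: tail_bound_arith h h1 st t0.
Qed.

(** On the event W ^ 2 <= 1 / t, the inequality T_lambda <= z implies W ^ 2
    <= z / (1 - e) and follows from W ^ 2 <= z / (1 + e), where e is the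
    relative error of [power_divergence_sandwich]. *)
Lemma power_divergence_kolmogorov t : 0 < t -> s ^+ 2 = t ^+ 5 -> t <= 1 / 100 -> s <= t ->
  `|lambda - 1| * t ^+ 2 <= 1 / 100 ->
  kolmogorov_dist (distribution P (power_divergence_stat p lambda X)) (chi_square1 R) <=
  6 * t + 16 * (`|lambda - 1| * t ^+ 2).
Proof.
move=> t0 st5 t1 st at2.
pose e := 4 * (`|lambda - 1| * t ^+ 2).
have at0 : 0 <= `|lambda - 1| * t ^+ 2 by apply: mulr_ge0; [exact: normr_ge0|exact: sqr_ge0].
have e0 : 0 <= e by apply: mulr_ge0 at0; exact: ler0n.
have e1 : e <= 4 / 100.
  have -> : 4 / 100 = 4 * (1 / 100) :> R by field.
  by apply: ler_wpM2l at2; exact: ler0n.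
have e1' : 0 < 1 - e by rewrite subr_gt0; apply: le_lt_trans e1 _; lra.
pose F z := fine (distribution P (pearson_stat p X) `]-oo, z]%classic).
pose E := pearson_stat p X @^-1` `]-oo, t^-1]%classic.
have mF z : measurable (pearson_stat p X @^-1` `]-oo, z]%classic) by exact: measurable_funPTI.
have mG z : measurable (power_divergence_stat p lambda X @^-1` `]-oo, z]%classic).
  exact: measurable_funPTI.
have mE : measurable (~` E) by apply: measurableC; exact: mF.
have tail : fine (P (~` E)) <= 5 * t by exact: pearson_tail.
have sand w : E w -> (1 - e) * W w ^+ 2 <= power_divergence_stat p lambda X w <= (1 + e) * W w ^+ 2.
  rewrite /E /= in_itv /= pearson_statE => Wt.
  have t2 : 0 < t ^+ 2 <= 1 / 2 by rewrite exprn_gt0 //=; nra.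
  apply: power_divergence_sandwich => //.
    by apply: le_trans at2 _; lra.
  rewrite -ler_sqr ?nnegrE; first last.
  - exact: sqr_ge0.
  - by apply: mulr_ge0; [exact: normr_ge0|exact: ltW].
  rewrite exprMn (real_normK (num_real _)) st5.
  have -> : (t ^+ 2) ^+ 2 = t^-1 * t ^+ 5 by field; rewrite gt_eqF.
  by apply: ler_wpM2r => //; rewrite exprn_ge0 // ltW.
have Fcdf z : 0 <= z -> `|F z - (Phi (Num.sqrt z) - Phi (- Num.sqrt z))| <= t.
  by move=> z0; apply: le_trans (pearson_cdf z0) _; apply: le_trans st; exact: rate_le s0.
apply: kolmogorov_dist_le => z.
rewrite -[fine (distribution _ _ _)]/(fine (P (power_divergence_stat p lambda X @^-1` `]-oo, z]%classic))).
set G := fine (P _).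
have [z0|z0] := leP 0 z; last first.
  rewrite chi_square1_lt0 // subr0 ger0_norm ?fine_ge0 //.
  have : G <= fine (P set0) + fine (P (~` E)).
    apply: fine_prob_le_setU => // w /=; rewrite in_itv /= => Tz; right => Ew.
    have /andP[h _] := sand w Ew.
    have : 0 <= (1 - e) * W w ^+ 2 by rewrite mulr_ge0 ?sqr_ge0 // ltW.
    by rewrite leNgt (le_lt_trans h) // (le_lt_trans Tz).
  rewrite measure0 /= add0r => h; apply: le_trans h _; apply: le_trans tail _.
  apply: (@le_trans _ _ (6 * t)); first lra.
  by rewrite lerDl; apply: mulr_ge0 at0; exact: ler0n.
rewrite chi_square1E //.
have e2' : 0 < 1 + e by rewrite ltr_wpDr.
have up : G <= F (z / (1 - e)) + fine (P (~` E)).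
  apply: fine_prob_le_setU => // w /=; rewrite in_itv /= => Tz.
  have [Ew|Ew] := pselect (E w); [left|by right].
  have /andP[h _] := sand w Ew.
  by rewrite in_itv /= pearson_statE ler_pdivlMr // mulrC (le_trans h).
have down : F (z / (1 + e)) <= G + fine (P (~` E)).
  apply: (@fine_prob_le_setU _ _ _ P (pearson_stat p X @^-1` `]-oo, z / (1 + e)]%classic)
    (power_divergence_stat p lambda X @^-1` `]-oo, z]%classic) (~` E)) => // w /=; rewrite in_itv /= pearson_statE => Tz.
  have [Ew|Ew] := pselect (E w); [left|by right].
  have /andP[_ h] := sand w Ew.
  by rewrite in_itv /=; apply: le_trans h _; rewrite mulrC -ler_pdivlMr.
have z1 : 0 <= z / (1 - e) by rewrite divr_ge0 // ltW.
have z2 : 0 <= z / (1 + e) by rewrite divr_ge0 // ltW.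
have := Phi_interval_scale z0 (_ : 1 <= (1 - e)^-1).
rewrite invf_ge1 // gerBl e0 => /(_ isT) S1.
have := Phi_interval_scale z2 (_ : 1 <= 1 + e).
rewrite lerDl e0 divfK ?gt_eqF // => /(_ isT) S2.
have := Fcdf _ z1; have := Fcdf _ z2; move: S1 S2 up down tail.
set K := Phi (Num.sqrt z) - Phi (- Num.sqrt z).
set K1 := Phi (Num.sqrt (z / (1 - e))) - _; set K2 := Phi (Num.sqrt (z / (1 + e))) - _.
move=> S1 S2 up down tail F2 F1.
have -> : 16 * (`|lambda - 1| * t ^+ 2) = 4 * e by rewrite /e; ring.
exact: sandwich_arith e0 e1 S1 S2 up down tail F2 F1.
Qed.

End PowerDivergence.
End TwoCells.

Unset Implicit Arguments.

Theorem corollary4p2 (R : realType) :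
  (forall (d : measure_display) (T : measurableType d) (P : probability T R)
      (n : nat) (p : 'I_2 -> R) (X : 'I_n -> {RV P >-> 'I_2}),
    (1 <= n)%N ->
    (forall j, 0 < p j < 1) ->
    p ord0 + p ord_max = 1 ->
    classification_trials p X ->
    kolmogorov_dist (distribution P (pearson_stat p X)) (chi_square1 R) <=
      (9496 / 10000) / Num.sqrt (n%:R * p ord0 * p ord_max)) /\
  (exists C1 C2 C3 : R,
    [/\ 0 < C1, 0 < C2, 0 < C3 &
    forall (d : measure_display) (T : measurableType d) (P : probability T R)
        (n : nat) (p : 'I_2 -> R) (X : 'I_n -> {RV P >-> 'I_2}) (lambda : R),
      (1 <= n)%N ->
      (forall j, 0 < p j < 1) ->
      p ord0 + p ord_max = 1 ->
      classification_trials p X ->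
      -1 < lambda ->
      kolmogorov_dist (distribution P (power_divergence_stat p lambda X))
          (chi_square1 R) <=
        1 / ((n%:R * p ord0 * p ord_max) `^ (1 / 5)) *
          (C1 + C2 * (lambda - 1) ^+ 2 +
           C3 * `|(lambda - 1) * (lambda - 2) * (12 * lambda + 13)| /
             ((lambda + 1) * (n%:R * p ord0 * p ord_max) `^ (2 / 5)))]).
Proof.
have q1 (p : 'I_2 -> R) : p ord0 + p ord_max = 1 -> p ord_max = 1 - p ord0.
  by move=> <-; rewrite addrAC subrr add0r.
split.
  move=> d T P n p X n0 p01 p1 trials.
  by rewrite (q1 p p1); exact: pearson_kolmogorov.
exists 100, 100, 1; split; [exact: ltr0n|exact: ltr0n|exact: ltr01|].
move=> d T P n p X lambda n0 p01 p1 trials l1.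
set V := n%:R * p ord0 * p ord_max.
have V0 : 0 < V.
  by rewrite !mulr_gt0 ?ltr0n //; [case/andP: (p01 ord0)|case/andP: (p01 ord_max)].
have v0 : 0 < V `^ (1 / 5) by exact: powR_gt0.
have w0 : 0 < V `^ (2 / 5) by exact: powR_gt0.
set t := 1 / V `^ (1 / 5).
have t0 : 0 < t by exact: divr_gt0.
have st5 : inv_stddev n (p ord0) ^+ 2 = t ^+ 5.
  have -> : inv_stddev n (p ord0) = (Num.sqrt V)^-1 by rewrite /inv_stddev /V (q1 p p1).
  have V5 : (V `^ (1 / 5)) ^+ 5 = V.
    by rewrite -powR_mulrn ?powR_ge0 // -powRrM divfK ?powRr1 ?pnatr_eq0 // ltW.
  by rewrite exprVn (sqr_sqrtr (ltW V0)) /t expr_div_n V5 expr1n div1r.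
have s0 := inv_stddev_gt0 n0 (p01 ord0).
set B3 := 1 * `|_| / _.
have B30 : 0 <= B3.
  apply: divr_ge0; first by rewrite mul1r.
  by rewrite mulr_ge0 // ltW // -ltrBlDr sub0r.
apply: (@le_trans _ _ (t * (100 + 100 * (lambda - 1) ^+ 2))); last first.
  by apply: ler_wpM2l; [exact: ltW|rewrite lerDl].
have [big|small] := leP 1 (t * (100 + 100 * (lambda - 1) ^+ 2)).
  by apply: le_trans big; apply: kolmogorov_dist_le => z; exact: prob_diff_le1.
rewrite -(real_normK (num_real (lambda - 1))) in small *.
have [t1 st at2 bal] := fifth_root_balance t0 s0 st5 (normr_ge0 _) small.
have k := power_divergence_kolmogorov n0 p01 p1 trials l1 t0 st5 t1 st at2.
exact: le_trans k bal.
Qed.
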